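(* Let $N\ge3$ and $t\ge1$ be integers. For $1\le a<b\le N$ let $E_{a,b}=|a\rangle\langle b|-|b\rangle\langle a|$ be the real skew-symmetric $N\times N$ matrix with entries $+1$ at $(a,b)$, $-1$ at $(b,a)$ and zero elsewhere, and let $\mathbf E_N=\{E_{a,b}:1\le a<b\le N\}$. Then \[ \Big\|\mathbb E_{\theta\sim(-\pi,\pi),\,E\in\mathbf E_N}\big(e^{\theta E}\big)^{\otimes t}-\mathbb E_{O\sim\mathrm{SO}(N)}O^{\otimes t}\Big\|\le1-\frac1t\frac{2(N-2)}{N(N-1)}-\frac2{N(N-1)}, \] where $\theta$ and $E$ are independent and uniform and $O$ is Haar-distributed on $\mathrm{SO}(N)$.
   Context: $\|\cdot\|$ is the operator norm. *)

(* Defs.v *)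
From HB Require Import structures.
From mathcomp Require Import all_boot all_order all_algebra.
From mathcomp Require Import all_classical all_reals all_analysis.
From mathcomp Require mxtens.

Set Implicit Arguments.
Unset Strict Implicit.
Unset Printing Implicit Defensive.

Import Order.TTheory GRing.Theory Num.Theory.
Import numFieldNormedType.Exports.
Local Open Scope classical_set_scope.
Local Open Scope ring_scope.

Section Defs.
Variable R : realType.

Definition tpow {n : nat} (A : 'M[R]_n) (t : nat) : 'M[R]_(n ^ t) :=
  mxtens.ntensmx A t.

Definition SOmx (N : nat) : set 'M[R]_N :=
  [set O | O^T *m O = 1%:M /\ \det O = 1].

Definition Emx (N : nat) (a b : 'I_N) : 'M[R]_N := delta_mx a b - delta_mx b a.

Definition expm (n : nat) (A : 'M[R]_n) : 'M[R]_n :=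
  limn (series (fun k : nat => (k`!%:R)^-1 *: (A ^+ k))).

Definition vnorm (n : nat) (x : 'cV[R]_n) : R := Num.sqrt (\sum_i (x i 0) ^+ 2).
Definition opnorm (m n : nat) (A : 'M[R]_(m, n)) : R :=
  sup [set vnorm (A *m x) | x in [set x : 'cV[R]_n | vnorm x <= 1]].

Definition pairs (N : nat) : {set 'I_N * 'I_N} := [set p : 'I_N * 'I_N | (val p.1 < val p.2)%N].

Definition rot_avg (N t : nat) : 'M[R]_(N ^ t) :=
  \matrix_(i, j)
    ((#|pairs N|%:R)^-1 *
     \sum_(p in pairs N)
        ((2 * pi)^-1 *
         Rintegral lebesgue_measure `](- pi), pi[%classic
           (fun theta : R => tpow (expm (theta *: Emx p.1 p.2)) t i j))).

Definition mx_borel (N : nat) : set (set 'M[R]_N) :=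
  <<s [set A : set 'M[R]_N | exists (i j : 'I_N) (B : set R),
                 measurable B /\ A = [set M : 'M[R]_N | B (M i j)]] >>.

Definition haarSO (N : nat) (d : measure_display) (T : measurableType d)
  (P : probability T R) (O : T -> 'M[R]_N) : Prop :=
  [/\ forall i j, measurable_fun setT (fun w => O w i j),
      forall w, SOmx (O w) &
      forall U, SOmx U -> forall A, mx_borel A ->
        P ((fun w => U *m O w) @^-1` A) = P (O @^-1` A)].

Definition haar_avg (N : nat) (d : measure_display) (T : measurableType d)
  (P : probability T R) (O : T -> 'M[R]_N) (t : nat) : 'M[R]_(N ^ t) :=
  \matrix_(i, j) Rintegral P setT (fun w => tpow (O w) t i j).

End Defs.

(* Main.v *)
Require Import Defs.
From HB Require Import structures.
From mathcomp Require Import all_boot all_order all_algebra.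
From mathcomp Require Import all_classical all_reals all_analysis.
From mathcomp Require Import measurable_realfun spectral complex mxtens ring lra.

(** Let [D a b] be the action of [E_{a,b}] on the tensor power. Averaging the
    rotations generated by [E_{a,b}] gives the orthogonal projector [P a b] onto
    [ker (D a b)], while the Haar average is the projector onto the common
    kernel of all the [D a b]. The Casimir operator [C = sum_{a<b} - (D a b)^2]
    is symmetric and commutes with every [D a b], so one can work inside an
    eigenspace [C = c] with [c <> 0]. The operators [- (D a b)^2] have spectrum
    in [{0, 1, 4, ..., t^2}]; let [k^2] be the largest eigenvalue occurring in the
    eigenspace for some pair. Raising operators annihilate the corresponding
    eigenvector, which gives [c >= k^2 + (N - 2) k] as for highest weights. On
    the other hand [1 - P a b >= - (D a b)^2 / k^2] on the eigenspace, so that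
    [sum_{a<b} (1 - P a b) >= c / k^2 >= 1 + (N - 2) / t]. *)

Set Implicit Arguments.
Unset Strict Implicit.
Unset Printing Implicit Defensive.

Import Order.TTheory GRing.Theory Num.Theory.
Import numFieldNormedType.Exports.
Local Open Scope classical_set_scope.
Local Open Scope ring_scope.

(** * Spectral decomposition of symmetric matrices *)

Section Dot.
Variables (R : realFieldType) (n : nat).
Implicit Types (x y z : 'cV[R]_n) (A : 'M[R]_n).

(** No Cartan subalgebra and no classification of highest weights is used: weights are read off one
    pair at a time, as eigenvalues of the real symmetric matrices [- (D a b)^2]. Taking [k] maximal
    over all pairs at once serves two purposes. At the pair where [k] is attained it makes the
    raised vectors vanish; at every other pair it bounds the weights by [k], so that
    [m^2 / k^2 <= 1]. The term [(N - 2) k] counts the indices outside [{a, b}], each of which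
    contributes [k]. Division by the [N(N - 1)/2] pairs then produces the two subtracted fractions
    of the bound. Two points lie outside the eigenspace estimate. An upper bound on the quadratic
    form controls the norm only because the average of the [P a b] is positive semidefinite. And
    vectors killed by all [D a b] must be matched with vectors fixed by SO(N), which requires that
    plane rotations generate the group. *)

Definition dot x y : R := (x^T *m y) 0 0.

Lemma dotE x y : dot x y = \sum_i x i 0 * y i 0.
Proof. by rewrite /dot mxE; apply: eq_bigr => i _; rewrite mxE. Qed.

Lemma dotC x y : dot x y = dot y x.
Proof. by rewrite !dotE; apply: eq_bigr => i _; rewrite mulrC. Qed.

Lemma dotDl x y z : dot (x + y) z = dot x z + dot y z.
Proof. by rewrite /dot linearD mulmxDl mxE. Qed.

Lemma dotDr x y z : dot z (x + y) = dot z x + dot z y.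
Proof. by rewrite /dot mulmxDr mxE. Qed.

Lemma dotZl a x y : dot (a *: x) y = a * dot x y.
Proof. by rewrite /dot linearZ -scalemxAl mxE. Qed.

Lemma dotZr a x y : dot x (a *: y) = a * dot x y.
Proof. by rewrite /dot -scalemxAr mxE. Qed.

Lemma dotNl x y : dot (- x) y = - dot x y.
Proof. by rewrite -scaleN1r dotZl mulN1r. Qed.

Lemma dotNr x y : dot x (- y) = - dot x y.
Proof. by rewrite -scaleN1r dotZr mulN1r. Qed.

Lemma dot0l x : dot 0 x = 0.
Proof. by rewrite -(scale0r (0 : 'cV_n)) dotZl mul0r. Qed.

Lemma dot0r x : dot x 0 = 0.
Proof. by rewrite dotC dot0l. Qed.

Lemma dot_suml I (r : seq I) (Q : pred I) (F : I -> 'cV[R]_n) y :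
  dot (\sum_(i <- r | Q i) F i) y = \sum_(i <- r | Q i) dot (F i) y.
Proof. by apply: (big_morph (dot^~ y)) => [u v|]; rewrite ?dotDl ?dot0l. Qed.

Lemma dot_sumr I (r : seq I) (Q : pred I) (F : I -> 'cV[R]_n) y :
  dot y (\sum_(i <- r | Q i) F i) = \sum_(i <- r | Q i) dot y (F i).
Proof. by rewrite dotC dot_suml; apply: eq_bigr => i _; rewrite dotC. Qed.

Lemma dot_mulmxl A x y : dot (A *m x) y = dot x (A^T *m y).
Proof. by rewrite /dot trmx_mul mulmxA. Qed.

Lemma dot_ge0 x : 0 <= dot x x.
Proof. by rewrite dotE sumr_ge0 // => i _; rewrite -expr2 sqr_ge0. Qed.

Lemma dot_eq0 x : (dot x x == 0) = (x == 0).
Proof.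
apply/eqP/eqP => [|->]; last by rewrite dot0l.
rewrite dotE => /eqP; rewrite psumr_eq0 => [/allP x0|i _]; last first.
  by rewrite -expr2 sqr_ge0.
apply/matrixP => i j; rewrite ord1 mxE.
by have /implyP/(_ isT) := x0 i (mem_index_enum i); rewrite mulf_eq0 orbb => /eqP.
Qed.

End Dot.

Section Spectral.
Variables (R : realFieldType) (n : nat) (S : 'M[R]_n).
Implicit Types (x y : 'cV[R]_n) (cs : seq R).

(** The product of the factors [S - c] acting on [x], kept as an iteration on vectors so that no
    matrix polynomial has to be formed. *)
Definition apply_roots cs x := foldl (fun y c => S *m y - c *: y) x cs.

(** Partial fractions, one root at a time: dividing the components of [(S - c0) x] by [c - c0] lifts
    them to components of [x], and the remainder is killed by [S - c0]. The predicate [V] keeps all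
    components inside a stable subspace, later an eigenspace of the Casimir operator. *)
Lemma eigen_decomposition (V : 'cV[R]_n -> Prop) cs x :
    V 0 -> (forall y z, V y -> V z -> V (y + z)) -> 
    (forall c y, V y -> V (c *: y)) -> (forall y, V y -> V (S *m y)) ->
    uniq cs -> V x -> apply_roots cs x = 0 ->
  exists2 y : R -> 'cV[R]_n,
    forall c, V (y c) /\ S *m y c = c *: y c & x = \sum_(c <- cs) y c.
Proof.
move=> V0 VD VZ VS; elim: cs x => [|c0 cs IH] x /=.
  move=> _ Vx ->; exists (fun=> 0); last by rewrite big_nil.
  by move=> c; rewrite mulmx0 scaler0.
have VB y z : V y -> V z -> V (y - z).
  by move=> Vy Vz; rewrite -[- z]scaleN1r; apply: VD => //; apply: VZ.
move=> /andP[c0cs ucs] Vx rx.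
have [y Vy xy] := IH _ ucs (VB _ _ (VS _ Vx) (VZ c0 _ Vx)) rx.
pose z c := (c - c0)^-1 *: y c.
have Vz c : V (z c) by apply: VZ; case: (Vy c).
have Sz c : S *m z c = c *: z c.
  by rewrite /z -scalemxAr (Vy c).2 !scalerA mulrC.
have Vsum r : V (\sum_(c <- r) z c).
  by apply: big_ind => // u v; apply: VD.
exists (fun c => if c == c0 then x - \sum_(c <- cs) z c else z c).
  move=> c; case: eqP => [->|_]; last by split.
  split; first exact: VB.
  suff E : S *m x - c0 *: x =
      S *m (\sum_(c <- cs) z c) - c0 *: \sum_(c <- cs) z c.
    rewrite mulmxBr scalerBr (canRL (subrK _) E).
    by rewrite addrAC [_ - c0 *: _]addrC addrK addrC.
  rewrite xy mulmx_sumr scaler_sumr -sumrB.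
  rewrite big_seq [RHS]big_seq; apply: eq_bigr => c1 c1cs.
  rewrite Sz -scalerBl /z scalerA divff ?scale1r // subr_eq0.
  by apply: contraNneq c0cs => <-.
rewrite big_cons eqxx [X in _ + X](eq_big_seq z) ?subrK // => c ccs.
by rewrite ifN //; apply: contraNneq c0cs => <-.
Qed.

Lemma eigen_orthogonal a b x y :
  S^T = S -> a != b -> S *m x = a *: x -> S *m y = b *: y -> dot x y = 0.
Proof.
move=> Ssym ab Sx Sy; apply/eqP.
have : a * dot x y == b * dot x y.
  by rewrite -dotZl -Sx dot_mulmxl Ssym Sy dotZr.
by rewrite -subr_eq0 -mulrBl mulf_eq0 subr_eq0 (negPf ab).
Qed.

End Spectral.

(** Over the complex numbers the matrix is Hermitian, hence diagonalisable with real eigenvalues. In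
    the eigenbasis the factor [A - c] multiplies the i-th coordinate by its eigenvalue minus [c], so
    the list of all eigenvalues annihilates every vector. *)
Lemma sym_apply_roots (R : rcfType) (n : nat) (A : 'M[R]_n) : A^T = A ->
  exists2 cs : seq R, uniq cs & forall x : 'cV[R]_n, apply_roots A cs x = 0.
Proof.
move=> Asym; pose f := real_complex R.
pose B := map_mx f A.
have Bh : B \is hermsymmx.
  apply/is_hermitianmxP; rewrite expr0 scale1r /B -map_trmx.
  apply/matrixP => i j; rewrite !mxE -{1}Asym mxE /=.
  by apply/eqP; rewrite eq_complex /= oppr0 !eqxx.
have /orthomx_spectralP : B \is normalmx by apply: hermitian_normalmx Bh.
set P := spectralmx B; set sp := spectral_diag B => BE.
have Pu : P \in unitmx by apply: spectral_unit.
have spr i : sp 0 i = f (complex.Re (sp 0 i)).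
  have /mxOverP/(_ 0 i) := hermitian_spectral_diag_real Bh.
  by move=> /complex_realP[r ->].
exists (undup [seq complex.Re (sp 0 i) | i : 'I_n]); first exact: undup_uniq.
move=> x; set cs := undup _.
have PB : P *m B = diag_mx sp *m P by rewrite {1}BE !mulmxA mulmxV // mul1mx.
suff Px r y i : (P *m map_mx f (apply_roots A r y)) i 0 =
    (\prod_(c <- r) (sp 0 i - f c)) * (P *m map_mx f y) i 0.
  have P0 : P *m map_mx f (apply_roots A cs x) = 0.
    apply/matrixP => i j; rewrite ord1 Px.
    rewrite (big_rem (complex.Re (sp 0 i))) /= -?spr ?subrr ?mul0r ?mxE //.
    by rewrite /cs mem_undup; apply: map_f; rewrite mem_enum.
  have : map_mx f (apply_roots A cs x) = 0.
    by rewrite -[LHS]mul1mx -(mulVmx Pu) -mulmxA P0 mulmx0.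
  move=> /matrixP M0; apply/matrixP => i j; have := M0 i j.
  by rewrite !mxE => -[].
elim: r y => [|c r IH] y /=; first by rewrite big_nil mul1r.
rewrite IH big_cons map_mxB map_mxM map_mxZ mulmxBr mulmxA -/B PB.
rewrite -mulmxA mul_diag_mx -scalemxAr !mxE.
by rewrite -mulrBl mulrCA mulrA.
Qed.

(** * The Casimir operator *)

(** With [y = B x], positivity of the form of [B] at [beta x - y], combined with the bound at [x]
    and at [y], gives [beta |y|^2 <= beta^3 |x|^2]. When [beta = 0] the vector [x - y] is used
    instead. *)
Lemma psd_norm_le (R : realFieldType) (n : nat) (B : 'M[R]_n)
    (V : 'cV[R]_n -> Prop) (beta : R) :
    (forall x y, dot x (B *m y) = dot (B *m x) y) ->
    (forall x, 0 <= dot x (B *m x)) ->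
    (forall x, V x -> V (B *m x)) -> 0 <= beta ->
    (forall x, V x -> dot x (B *m x) <= beta * dot x x) ->
  forall x, V x -> dot (B *m x) (B *m x) <= beta ^+ 2 * dot x x.
Proof.
move=> Bsym B0 VB b0 Bb x Vx; set y := B *m x.
have H s : 0 <= s ^+ 2 * dot x y - 2 * s * dot y y + dot y (B *m y).
  have := B0 (s *: x - y); rewrite mulmxBr -scalemxAr -/y !(dotDl, dotDr, dotNl, dotNr).
  rewrite !(dotZl, dotZr).
  rewrite (Bsym x y) -/y => h; rewrite (le_trans h) // le_eqVlt.
  by apply/orP; left; apply/eqP; ring.
have bx := Bb _ Vx; have by_ := Bb _ (VB _ Vx); rewrite -/y in bx by_.
have [b0'|bn0] := eqVneq beta 0.
  have := H 1; rewrite b0' !mul0r in bx by_ *.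
  by rewrite expr0n mul0r expr1n mul1r mulr1; lra.
have bp : 0 < beta by rewrite lt_def bn0.
rewrite -subr_ge0 -(pmulr_rge0 _ bp); have := H beta.
have : beta ^+ 2 * dot x y <= beta ^+ 2 * (beta * dot x x).
  by rewrite ler_wpM2l ?sqr_ge0.
by move: by_; set d := dot y y; set e := dot y _; set f := dot x x; set g := dot x y; nra.
Qed.

Lemma sum_delta (R : pzRingType) (V : lmodType R) (I : finType) (i : I)
    (F : I -> V) :
  \sum_j (i == j)%:R *: F j = F i.
Proof.
rewrite (bigD1 i) //= eqxx scale1r big1 ?addr0 // => j ji.
by rewrite eq_sym (negPf ji) scale0r.
Qed.

(** Sums over all ordered pairs let Kronecker deltas be contracted without distinguishing the order
    of the indices; the price is a factor 2. *)
Lemma sum_ltn_pairs (V : zmodType) (N : nat) (F : 'I_N -> 'I_N -> V) :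
    (forall a b, F a b = F b a) -> (forall a, F a a = 0) ->
  \sum_a \sum_b F a b = (\sum_(p : 'I_N * 'I_N | (p.1 < p.2)%N) F p.1 p.2) *+ 2.
Proof.
move=> Fsym F0; rewrite pair_bigA /=.
rewrite (bigID (fun p : 'I_N * 'I_N => (p.1 < p.2)%N)) /= mulr2n; congr (_ + _).
rewrite [RHS](reindex_inj (h := fun p => (p.2, p.1))) /=; last first.
  by move=> [a b] [c d] [-> ->].
rewrite big_mkcond [RHS]big_mkcond /=; apply: eq_bigr => -[a b] _ /=.
by rewrite -leqNgt; case: (ltngtP a b) => //= /val_inj ->.
Qed.

Section Casimir.
Variables (R : rcfType) (n N : nat) (D : 'I_N -> 'I_N -> 'M[R]_n).
Hypothesis Dskew : forall a b, (D a b)^T = - D a b.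
Hypothesis Danti : forall a b, D b a = - D a b.
Hypothesis Dcomm : forall a b c d, D a b *m D c d - D c d *m D a b =
  (b == c)%:R *: D a d - (a == c)%:R *: D b d
  - (b == d)%:R *: D a c + (a == d)%:R *: D b c.

Let sq a b := - (D a b *m D a b).

Definition casimir := \sum_(p : 'I_N * 'I_N | (p.1 < p.2)%N) sq p.1 p.2.

Definition invariant (x : 'cV[R]_n) := forall a b, D a b *m x = 0.

Lemma Ddiag a : D a a = 0.
Proof.
have /eqP := Danti a a; rewrite -addr_eq0 -mulr2n => /eqP D0.
by apply: (scalerI (a := 2%:R)); rewrite ?pnatr_eq0 // scaler0 scaler_nat.
Qed.

Lemma dot_sq a b x y : dot x (sq a b *m y) = dot (D a b *m x) (D a b *m y).
Proof. by rewrite dot_mulmxl Dskew !mulNmx mulmxA. Qed.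

Lemma sq_sym a b : (sq a b)^T = sq a b.
Proof. by rewrite /sq linearN /= trmx_mul Dskew mulNmx mulmxN opprK. Qed.

Lemma casimir_sym : casimir^T = casimir.
Proof. by rewrite /casimir linear_sum; apply: eq_bigr => p _; apply: sq_sym. Qed.

Lemma casimir2 : casimir *+ 2 = - \sum_a \sum_b D a b *m D a b.
Proof.
rewrite /casimir -(sum_ltn_pairs (F := sq)).
- by rewrite -sumrN; apply: eq_bigr => a _; rewrite -sumrN.
- by move=> a b; rewrite /sq (Danti a b) mulNmx mulmxN opprK.
- by move=> a; rewrite /sq Ddiag mul0mx oppr0.
Qed.

(** By the Leibniz rule the commutator with twice the Casimir splits into [K a b] times [D a b] and
    [D a b] times [K a b]. Contracting the deltas turns these two sums into opposite multiples of
    [G - G']. *)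
Lemma casimir_comm c d : D c d *m casimir = casimir *m D c d.
Proof.
apply: (scalerI (a := 2%:R)); rewrite ?pnatr_eq0 //.
rewrite scalemxAr scalemxAl scaler_nat casimir2 mulNmx mulmxN; congr (- _).
apply/eqP; rewrite -subr_eq0 mulmx_sumr mulmx_suml -sumrB.
pose G := \sum_b D c b *m D d b; pose G' := \sum_b D d b *m D c b.
pose K a b := D c d *m D a b - D a b *m D c d.
have -> : \sum_a (D c d *m (\sum_b D a b *m D a b) -
                  (\sum_b D a b *m D a b) *m D c d) =
          \sum_a \sum_b K a b *m D a b + \sum_a \sum_b D a b *m K a b.
  rewrite -big_split; apply: eq_bigr => a _.
  rewrite mulmx_sumr mulmx_suml -sumrB -big_split; apply: eq_bigr => b _ /=.
  by rewrite /K mulmxBl mulmxBr addrA !mulmxA subrK.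
have E1 : \sum_a \sum_b K a b *m D a b = (G - G') *+ 2.
  under eq_bigr => a _.
    under eq_bigr => b _ do
      rewrite /K Dcomm !mulmxDl !mulNmx -!scalemxAl.
    rewrite !big_split /= !sumrN -!scaler_sumr.
    rewrite (sum_delta d (fun b => D c a *m D a b)).
    rewrite (sum_delta c (fun b => D d a *m D a b)).
    over.
  rewrite !big_split /= !sumrN.
  rewrite (sum_delta d (fun a => \sum_b D c b *m D a b)).
  rewrite (sum_delta c (fun a => \sum_b D d b *m D a b)).
  rewrite -/G -/G' mulr2n -!addrA; congr (_ + (_ + _)).
  congr (_ + _); rewrite -?sumrN; apply: eq_bigr => a _.
    by rewrite (Danti d a) mulmxN opprK.
  by rewrite (Danti c a) mulmxN.
have E2 : \sum_a \sum_b D a b *m K a b = (G' - G) *+ 2.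
  under eq_bigr => a _.
    under eq_bigr => b _ do
      rewrite /K Dcomm !mulmxDr !mulmxN -!scalemxAr.
    rewrite !big_split /= !sumrN -!scaler_sumr.
    rewrite (sum_delta d (fun b => D a b *m D c a)).
    rewrite (sum_delta c (fun b => D a b *m D d a)).
    over.
  rewrite !big_split /= !sumrN.
  rewrite (sum_delta d (fun a => \sum_b D a b *m D c b)).
  rewrite (sum_delta c (fun a => \sum_b D a b *m D d b)).
  rewrite -/G -/G' mulr2n -!addrA; congr (_ + (_ + _)).
  congr (_ + _); rewrite -?sumrN; apply: eq_bigr => a _.
    by rewrite (Danti d a) mulNmx opprK.
  by rewrite (Danti c a) mulNmx.
by rewrite E1 E2 -mulrnDl addrA subrK subrr mul0rn.
Qed.

Lemma dot_casimir x :
  dot x (casimir *m x) =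
  \sum_(p : 'I_N * 'I_N | (p.1 < p.2)%N) dot (D p.1 p.2 *m x) (D p.1 p.2 *m x).
Proof.
rewrite /casimir mulmx_suml dotC dot_suml.
by apply: eq_bigr => p _; rewrite dotC dot_sq.
Qed.

Lemma casimir0_invariant x : casimir *m x = 0 -> invariant x.
Proof.
move=> Cx; have : dot x (casimir *m x) = 0 by rewrite Cx dot0r.
rewrite dot_casimir => /eqP; rewrite psumr_eq0 => [/allP H|p _]; last exact: dot_ge0.
have {}H (a b : 'I_N) : (a < b)%N -> D a b *m x = 0.
  move=> ab; apply/eqP; rewrite -dot_eq0.
  by have /implyP := H (a, b) (mem_index_enum _); apply.
move=> a b; case: (ltngtP a b) => [|ba|/val_inj ->]; first exact: H.
  by rewrite Danti mulNmx H // oppr0.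
by rewrite Ddiag mul0mx.
Qed.

Lemma invariant_casimir0 x : invariant x -> casimir *m x = 0.
Proof.
move=> Ix; rewrite /casimir mulmx_suml big1 // => p _.
by rewrite /sq mulNmx -mulmxA Ix mulmx0 oppr0.
Qed.

Lemma casimir_comm_sq c d : sq c d *m casimir = casimir *m sq c d.
Proof. by rewrite /sq mulNmx mulmxN -mulmxA casimir_comm !mulmxA casimir_comm. Qed.

(** * Lower bound on the Casimir eigenvalue from a vector of maximal weight *)

Section HighestWeight.
Variables (c : R) (k : nat) (a b : 'I_N) (v : 'cV[R]_n).
Hypotheses (ab : a != b) (k_gt0 : (0 < k)%N).
Hypothesis Cv : casimir *m v = c *: v.
Hypothesis Hv : sq a b *m v = k%:R ^+ 2 *: v.
Hypothesis Hmax : forall w : 'cV[R]_n, casimir *m w = c *: w ->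
  sq a b *m w = k.+1%:R ^+ 2 *: w -> w = 0.

Let kr : R := k%:R.
Let kr_neq0 : kr != 0. Proof. by rewrite pnatr_eq0 -lt0n. Qed.
Let u := kr^-1 *: (D a b *m v).
Let Du : D a b *m v = kr *: u.
Proof. by rewrite /u scalerA divff // scale1r. Qed.
Let Dv : D a b *m u = - kr *: v.
Proof.
rewrite /u -scalemxAr mulmxA -[D a b *m D a b]opprK mulNmx Hv -scalerN scalerA.
by rewrite expr2 mulrA mulVf // mul1r scalerN scaleNr.
Qed.
Let casD (p q : 'I_N) (x : 'cV[R]_n) :
  casimir *m x = c *: x -> casimir *m (D p q *m x) = c *: (D p q *m x).
Proof. by move=> Cx; rewrite mulmxA -casimir_comm -mulmxA Cx -scalemxAr. Qed.
Let Cu : casimir *m u = c *: u.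
Proof. by rewrite /u -scalemxAr casD // !scalerA mulrC. Qed.

(* [v] and [u] are the real and imaginary parts of a vector of maximal weight [k]
   for [D a b]; a raising operator sends it to a vector of weight [k + 1], whose
   real and imaginary parts [w] and [w'] below therefore vanish. *)
Lemma raising_eq0 j : j != a -> j != b ->
  D a j *m v = - (D b j *m u) /\ D b j *m v = D a j *m u.
Proof.
move=> ja jb.
have HX : D a b *m D a j = D a j *m D a b - D b j.
  have := Dcomm a b a j; rewrite eqxx (eq_sym b a) (negPf ab).
  rewrite (eq_sym b) (negPf jb) (eq_sym a) (negPf ja) !scale0r scale1r.
  by rewrite subr0 addr0 sub0r addrC => <-; rewrite addrA subrr add0r.
have HY : D a b *m D b j = D b j *m D a b + D a j.
  have := Dcomm a b b j; rewrite eqxx (negPf ab).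
  rewrite (eq_sym b) (negPf jb) (eq_sym a) (negPf ja) !scale0r scale1r.
  by rewrite subr0 addr0 subr0 => <-; rewrite addrC subrK.
pose w := D a j *m v + D b j *m u; pose w' := D a j *m u - D b j *m v.
have Hw : D a b *m w = (kr + 1) *: w'.
  rewrite /w /w' mulmxDr !mulmxA HX HY mulmxBl mulmxDl -!mulmxA Du Dv.
  rewrite -!scalemxAr; move: (D a j *m u) (D b j *m v) => X Y.
  by apply/matrixP => i i'; rewrite !mxE; ring.
have Hw' : D a b *m w' = - (kr + 1) *: w.
  rewrite /w /w' mulmxBr !mulmxA HX HY mulmxBl mulmxDl -!mulmxA Du Dv.
  rewrite -!scalemxAr; move: (D a j *m v) (D b j *m u) => X Y.
  by apply/matrixP => i i'; rewrite !mxE; ring.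
have kk : k.+1%:R = kr + 1 :> R by rewrite -natr1.
have w0 : w = 0.
  apply: Hmax; first by rewrite mulmxDr !casD // scalerDr.
  by rewrite mulNmx -mulmxA Hw -scalemxAr Hw' scalerA mulrN scaleNr opprK kk expr2.
have w'0 : w' = 0.
  apply: (scalerI (a := kr + 1)); first by rewrite -kk pnatr_eq0.
  by rewrite -Hw w0 mulmx0 scaler0.
split; apply/eqP; first by rewrite -addr_eq0 -/w w0.
by rewrite eq_sym -subr_eq0 -/w' w'0.
Qed.

Let g p q := dot (D p q *m v) (D p q *m v).

(** Substituting the raising relations into [- (D a j)^2 v - (D b j)^2 v] leaves the commutator of
    [D a j] and [D b j] applied to [u], that is [- D a b u = k v]. *)
Lemma dot_raising j : j != a -> j != b -> g a j + g b j = kr * dot v v.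
Proof.
move=> ja jb; have [Xv Yv] := raising_eq0 ja jb.
rewrite /g -!dot_sq -dotDr /sq !mulNmx -!mulmxA Xv Yv mulmxN opprK !mulmxA -mulmxBl.
have := Dcomm a j b j; rewrite eqxx (negPf ab) (negPf jb).
rewrite (eq_sym a) (negPf ja) !scale0r scale1r subr0 sub0r addr0 => ->.
by rewrite mulNmx Dv scaleNr opprK dotZr.
Qed.

(** In the Casimir form at [v] the pair [{a, b}] contributes [k^2], the pairs meeting it in one
    index contribute [k] for each of the [N - 2] remaining indices, and the other pairs are
    nonnegative and dropped. *)
Lemma casimir_ge : v != 0 -> kr ^+ 2 + kr * (N - 2)%:R <= c.
Proof.
move=> v0; have vv : 0 < dot v v by rewrite lt_def dot_eq0 v0 dot_ge0.
rewrite -(ler_pM2r vv).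
have g0 p q : 0 <= g p q by apply: dot_ge0.
have gsym p q : g p q = g q p by rewrite /g (Danti q p) mulNmx dotNl dotNr opprK.
have gd p : g p p = 0 by rewrite /g Ddiag mul0mx dot0l.
have gab : g a b = kr ^+ 2 * dot v v by rewrite /g -dot_sq Hv dotZr.
have split2 (V : nmodType) (F : 'I_N -> V) :
    \sum_j F j = F a + (F b + \sum_(j | (j != a) && (j != b)) F j).
  by rewrite (bigD1 a) //= (bigD1 b) //= eq_sym.
have cardE : (N = (\sum_(j < N | (j != a) && (j != b)) 1).+2)%N.
  by rewrite -[in LHS](card_ord N) -sum1_card (split2 nat (fun=> 1%N)).
have NE : (N - 2 = \sum_(j < N | (j != a) && (j != b)) 1)%N.
  by rewrite [in LHS]cardE subSS subSS subn0.
have -> : c * dot v v = \sum_(p : 'I_N * 'I_N | (p.1 < p.2)%N) g p.1 p.2.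
  by rewrite -dotZr -Cv dot_casimir.
suff : (kr ^+ 2 + kr * (N - 2)%:R) * dot v v *+ 2 <= \sum_p \sum_q g p q.
  by rewrite sum_ltn_pairs // lerMn2r orFb.
pose G := \sum_(j | (j != a) && (j != b)) (g a j + g b j).
have GE : G = kr * (N - 2)%:R * dot v v.
  rewrite /G (eq_bigr (fun=> kr * dot v v)); last first.
    by move=> j /andP[ja jb]; apply: dot_raising.
  rewrite NE natr_sum -mulrA mulrCA mulr_suml.
  by apply: eq_bigr => j _; rewrite mul1r.
have rowge p : g p a + g p b <= \sum_q g p q.
  by rewrite split2 addrA lerDl sumr_ge0.
rewrite split2 2!split2 gd gd (gsym b a).
have : G <= \sum_(j | (j != a) && (j != b)) \sum_q g j q.
  by apply: ler_sum => j _; rewrite (gsym a) (gsym b).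
have : G = \sum_(j | (j != a) && (j != b)) g a j +
           \sum_(j | (j != a) && (j != b)) g b j by rewrite /G big_split.
rewrite gab GE mulr2n mulrDl.
by move=> *; lra.
Qed.

End HighestWeight.

Definition casimir_eigen (c : R) (x : 'cV[R]_n) := casimir *m x = c *: x.

(** * From weights to the spectral gap of the averaged projectors *)

Section Gap.
Variables (t : nat) (Pr : 'I_N -> 'I_N -> 'M[R]_n).
Hypothesis t_gt0 : (0 < t)%N.
Hypothesis sq_roots : forall a b, a != b -> forall x,
  apply_roots (sq a b) [seq m%:R ^+ 2 | m <- iota 0 t.+1] x = 0.
Hypothesis PrE : forall a b, a != b -> forall m (x : 'cV[R]_n), (m <= t)%N ->
  sq a b *m x = m%:R ^+ 2 *: x -> Pr a b *m x = (m == 0%N)%:R *: x.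

Let sqrn_inj : injective (fun m : nat => m%:R ^+ 2 : R).
Proof.
move=> m1 m2 /eqP; rewrite -subr_eq0 subr_sqr mulf_eq0 subr_eq0 eqr_nat.
rewrite -natrD pnatr_eq0 addn_eq0 => /orP[/eqP //|/andP[/eqP-> /eqP->] //].
Qed.

Section Weights.
Variables (a b : 'I_N).
Hypothesis ab : a != b.

Lemma weight_decomposition (V : 'cV[R]_n -> Prop) x :
    V 0 -> (forall y z, V y -> V z -> V (y + z)) ->
    (forall c y, V y -> V (c *: y)) -> (forall y, V y -> V (sq a b *m y)) -> V x ->
  exists2 z : nat -> 'cV[R]_n,
    forall m, V (z m) /\ sq a b *m z m = m%:R ^+ 2 *: z m
    & x = \sum_(m < t.+1) z m.
Proof.
move=> V0 VD VZ VS Vx.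
have [|y Hy xy] := eigen_decomposition V0 VD VZ VS _ Vx (sq_roots ab x).
  by rewrite (map_inj_uniq sqrn_inj) iota_uniq.
exists (fun m => y (m%:R ^+ 2)) => [m|]; first exact: Hy.
by rewrite xy big_map -[iota 0 t.+1]/(index_iota 0 t.+1) big_mkord.
Qed.

Lemma weight_orth m1 m2 x y : m1 != m2 ->
  sq a b *m x = m1%:R ^+ 2 *: x -> sq a b *m y = m2%:R ^+ 2 *: y -> dot x y = 0.
Proof.
move=> m12; apply: eigen_orthogonal; first exact: sq_sym.
by apply: contra m12 => /eqP/sqrn_inj ->.
Qed.

Lemma weight_dot (z : nat -> 'cV[R]_n) x m :
    (forall m, sq a b *m z m = m%:R ^+ 2 *: z m) -> (m < t.+1)%N ->
    sq a b *m x = m%:R ^+ 2 *: x ->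
  dot (\sum_(m < t.+1) z m) x = dot (z m) x.
Proof.
move=> Hz mt Hx; rewrite dot_suml (bigD1 (Ordinal mt)) //= big1 ?addr0 // => i im.
by apply: weight_orth Hx; first exact: im.
Qed.

Lemma projector_weights (z : nat -> 'cV[R]_n) :
    (forall m, sq a b *m z m = m%:R ^+ 2 *: z m) ->
  Pr a b *m (\sum_(m < t.+1) z m) = z 0%N.
Proof.
move=> Hz; rewrite mulmx_sumr big_ord_recl /= (PrE ab _ (Hz _)) // scale1r.
rewrite big1 ?addr0 // => i _; rewrite (PrE ab _ (Hz _)) ?scale0r //.
Qed.

Lemma full_weights x : exists2 z : nat -> 'cV[R]_n,
  forall m, sq a b *m z m = m%:R ^+ 2 *: z m & x = \sum_(m < t.+1) z m.
Proof.
have [//|//|//|//|//|z Hz xz] := @weight_decomposition (fun=> True) x.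
by exists z => // m; case: (Hz m).
Qed.

(** [Pr a b] is known only through its action on weight vectors; symmetry follows because it
    extracts the weight-zero component and distinct weights are orthogonal. *)
Lemma projector_sym x y : dot x (Pr a b *m y) = dot (Pr a b *m x) y.
Proof.
have [z Hz ->] := full_weights x; have [z' Hz' ->] := full_weights y.
rewrite !projector_weights // (weight_dot Hz _ (Hz' 0%N)) //.
by rewrite [RHS]dotC (weight_dot Hz' _ (Hz 0%N)) // dotC.
Qed.

Lemma projector_ge0 x : 0 <= dot x (Pr a b *m x).
Proof.
have [z Hz ->] := full_weights x.
by rewrite projector_weights // (weight_dot Hz _ (Hz 0%N)) // dot_ge0.
Qed.

Lemma projector_invariant x : invariant x -> Pr a b *m x = x.
Proof.
move=> Ix; rewrite (PrE (m := 0) ab) ?scale1r //.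
by rewrite /sq mulNmx -mulmxA Ix mulmx0 oppr0 expr0n scale0r.
Qed.

End Weights.

Section Eigenspace.
Variable c : R.
Local Notation V := (casimir_eigen c).

Let V0 : V 0. Proof. by rewrite /casimir_eigen mulmx0 scaler0. Qed.
Let VD y z : V y -> V z -> V (y + z).
Proof. by rewrite /casimir_eigen mulmxDr scalerDr => -> ->. Qed.
Let VZ r y : V y -> V (r *: y).
Proof. by rewrite /casimir_eigen -scalemxAr => ->; rewrite !scalerA mulrC. Qed.
Let Vsq a b y : V y -> V (sq a b *m y).
Proof. by rewrite /casimir_eigen mulmxA -casimir_comm_sq -mulmxA => ->; rewrite scalemxAr. Qed.

Lemma projector_eigenspace a b x : a != b -> V x -> V (Pr a b *m x).
Proof.
move=> ab Vx; have [z Hz ->] := weight_decomposition ab V0 VD VZ (Vsq a b) Vx.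
by rewrite projector_weights // => [|m]; case: (Hz 0%N) => // ? ?; case: (Hz m).
Qed.

(** A positive weight must occur: otherwise every [D a b] kills [x], so the Casimir does too,
    against [c != 0]. The largest one, over all pairs, satisfies the hypotheses of [casimir_ge]. *)
Lemma max_weight x : c != 0 -> V x -> x != 0 ->
  exists2 k : nat, (0 < k <= t)%N /\ k%:R ^+ 2 + k%:R * (N - 2)%:R <= c
    & forall a b y m, a != b -> V y -> sq a b *m y = m%:R ^+ 2 *: y ->
        (k < m <= t)%N -> y = 0.
Proof.
move=> c0 Vx x0.
pose Q m := `[< exists a b v, [/\ a != b, V v, v != 0 & sq a b *m v = m%:R ^+ 2 *: v] >].
have exQ : exists m, (0 < m <= t)%N && Q m.
  apply/not_existsP => noQ; case/eqP: x0.
  suff Ix : invariant x.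
    apply: (scalerI c0); rewrite scaler0 -[LHS]Vx; exact: invariant_casimir0.
  move=> a b; have [->|ab] := eqVneq a b; first by rewrite Ddiag mul0mx.
  have [z Hz xz] := weight_decomposition ab V0 VD VZ (Vsq a b) Vx.
  have z0 m : (0 < m <= t)%N -> z m = 0.
    move=> mt; apply/eqP/negPn/negP => zm0; apply: (noQ m); rewrite mt.
    by apply/asboolP; exists a, b, (z m); case: (Hz m).
  apply/eqP; rewrite -dot_eq0 -dot_sq {2}xz mulmx_sumr big1 ?dot0r // => i _.
  rewrite (Hz i).2; case: (posnP i) => [->|i0]; first by rewrite expr0n scale0r.
  by rewrite z0 ?scaler0 // i0 -ltnS ltn_ord.
have bQ m : (0 < m <= t)%N && Q m -> (m <= t)%N by case/andP => /andP[].
case: (ex_maxnP exQ bQ) => k /andP[kt /asboolP[a [b [v [ab Vv v0 Hv]]]]] kmax.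
have big0 a' b' y m : a' != b' -> V y -> sq a' b' *m y = m%:R ^+ 2 *: y ->
    (k < m <= t)%N -> y = 0.
  move=> ab' Vy Hy /andP[km mt]; apply/eqP/negPn/negP => y0.
  have := kmax m; rewrite (leq_trans _ km) // mt leqNgt km => /(_ _)/negP; apply=> //.
  by apply/asboolP; exists a', b', y.
exists k => //; split=> //; apply: (casimir_ge ab _ Vv Hv _ v0).
  by case/andP: kt.
(* Maximality only covers weights up to [t]. If [k = t], a vector of weight [k + 1] is orthogonal to
   all its own components, hence zero. *)
move=> w Vw Hw; apply/eqP; rewrite -dot_eq0; apply/eqP.
have [z Hz wz] := weight_decomposition ab V0 VD VZ (Vsq a b) Vw.
rewrite {1}wz dot_suml big1 // => i _.
have [ik|ik] := eqVneq (i : nat) k.+1.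
  have [Vz sz] := Hz i; rewrite (big0 a b (z i) i ab Vz sz) ?dot0l //.
  by rewrite ik ltnSn -ik -ltnS ltn_ord.
by apply: (weight_orth ik) Hw; case: (Hz i).
Qed.

Let tr : R := t%:R.

Lemma eigenspace_gap x : c != 0 -> V x ->
  (1 + (N - 2)%:R / tr) * dot x x <=
  \sum_(p : 'I_N * 'I_N | (p.1 < p.2)%N) (dot x x - dot x (Pr p.1 p.2 *m x)).
Proof.
move=> c0 Vx; have [->|x0] := eqVneq x 0.
  by rewrite dot0l mulr0 sumr_ge0 // => p _; rewrite dot0l subr0.
have [k [/andP[k0 kt] ck] kmax] := max_weight c0 Vx x0.
have xx : 0 < dot x x by rewrite lt_def dot_eq0 x0 dot_ge0.
have kr0 : 0 < k%:R :> R by rewrite ltr0n.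
(* In terms of weight components the left side is the sum of [m^2 / k^2 * |z m|^2] and the right
   side the sum of [|z m|^2] over [m >= 1]. Weight zero enters neither, and components with [m > k]
   vanish. *)
have H a b : a != b ->
    (k%:R ^+ 2)^-1 * dot (D a b *m x) (D a b *m x) <= dot x x - dot x (Pr a b *m x).
  move=> ab; have [z Hz xz] := weight_decomposition ab V0 VD VZ (Vsq a b) Vx.
  have Hz2 m : sq a b *m z m = m%:R ^+ 2 *: z m by case: (Hz m).
  have dz m : (m < t.+1)%N -> dot x (z m) = dot (z m) (z m).
    by move=> mt; rewrite xz (weight_dot Hz2 mt).
  have -> : dot x (Pr a b *m x) = dot (z 0%N) (z 0%N).
    by rewrite {2}xz projector_weights // dz.
  rewrite -dot_sq.
  have -> : dot x (sq a b *m x) = \sum_(m < t.+1) m%:R ^+ 2 * dot (z m) (z m).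
    rewrite {2}xz mulmx_sumr dot_sumr; apply: eq_bigr => m _.
    by rewrite Hz2 dotZr dz.
  have -> : dot x x = \sum_(m < t.+1) dot (z m) (z m).
    by rewrite {2}xz dot_sumr; apply: eq_bigr => m _; rewrite dz.
  rewrite !big_ord_recl /= expr0n mul0r add0r [X in _ <= X]addrC addrA addNr add0r.
  rewrite mulr_sumr; apply: ler_sum => i _.
  have [ik|ik] := leqP (lift ord0 i) k; last first.
    have [Vz sz] := Hz (lift ord0 i).
    rewrite (kmax a b (z (lift ord0 i)) (lift ord0 i) ab Vz sz) ?dot0l ?mulr0 //.
    by rewrite ik -ltnS ltn_ord.
  rewrite mulrA -[X in _ <= X]mul1r ler_wpM2r ?dot_ge0 //.
  by rewrite mulrC ler_pdivrMr ?exprn_gt0 // mul1r lerXn2r ?nnegrE ?ler0n // ler_nat.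
apply: (@le_trans _ _ (\sum_(p : 'I_N * 'I_N | (p.1 < p.2)%N)
    (k%:R ^+ 2)^-1 * dot (D p.1 p.2 *m x) (D p.1 p.2 *m x))); last first.
  apply: ler_sum => p pp; apply: H.
  by apply/eqP => pq; move: pp; rewrite pq ltnn.
rewrite -mulr_sumr -dot_casimir Vx dotZr mulrA ler_pM2r //.
rewrite [X in _ <= X]mulrC ler_pdivlMr ?exprn_gt0 //; apply: le_trans ck.
rewrite mulrDl mul1r lerD2l expr2 mulrA.
rewrite [X in X <= _]mulrC ler_wpM2l ?ler0n // mulrAC ler_pdivrMr ?ltr0n //.
by rewrite ler_wpM2l ?ler0n // ler_nat.
Qed.

End Eigenspace.

Let np : nat := \sum_(p : 'I_N * 'I_N | (p.1 < p.2)%N) 1.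
Let M : 'M[R]_n := np%:R^-1 *: \sum_(p : 'I_N * 'I_N | (p.1 < p.2)%N) Pr p.1 p.2.
Let beta : R := 1 - (1 + (N - 2)%:R / t%:R) / np%:R.

Let neq_pair (p : 'I_N * 'I_N) : (p.1 < p.2)%N -> p.1 != p.2.
Proof. by move=> pp; apply/eqP => pq; move: pp; rewrite pq ltnn. Qed.

(** Split [x] into Casimir eigenvectors. The component at [c = 0] is invariant, so [M] and [Pi]
    agree on it; the others are orthogonal to the invariants, so only [M] acts. Since [M] preserves
    the eigenspaces, the estimates add up by Pythagoras. *)
Lemma average_gap (Pi : 'M[R]_n) (x : 'cV[R]_n) :
    (0 < np)%N -> 0 <= beta ->
    (forall y, invariant y -> Pi *m y = y) ->
    (forall y, (forall z, invariant z -> dot y z = 0) -> Pi *m y = 0) ->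
  dot ((M - Pi) *m x) ((M - Pi) *m x) <= beta ^+ 2 * dot x x.
Proof.
move=> np0 b0 Pi1 Pi0.
have npr : 0 < np%:R :> R by rewrite ltr0n.
have npE : \sum_(p : 'I_N * 'I_N | (p.1 < p.2)%N) 1 = np%:R :> R.
  by rewrite /np natr_sum.
have Minv y : invariant y -> M *m y = y.
  move=> Iy; rewrite /M -scalemxAl mulmx_suml.
  rewrite (eq_bigr (fun=> 1 *: y)) => [|p pp]; last first.
    by rewrite projector_invariant ?neq_pair // scale1r.
  by rewrite -scaler_suml npE scalerA mulVf ?scale1r // gt_eqF.
have MV c (y : 'cV[R]_n) : casimir *m y = c *: y -> casimir *m (M *m y) = c *: (M *m y).
  move=> Cy; have -> : M *m y = np%:R^-1 *:
      \sum_(p : 'I_N * 'I_N | (p.1 < p.2)%N) Pr p.1 p.2 *m y.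
    by rewrite -scalemxAl mulmx_suml.
  rewrite -scalemxAr mulmx_sumr.
  rewrite scalerA mulrC -scalerA; congr (_ *: _); rewrite scaler_sumr.
  by apply: eq_bigr => p pp; exact: (projector_eigenspace (neq_pair pp) Cy).
have Mdot (y z : 'cV[R]_n) : dot y (M *m z) = np%:R^-1 *
    \sum_(p : 'I_N * 'I_N | (p.1 < p.2)%N) dot y (Pr p.1 p.2 *m z).
  by rewrite /M -scalemxAl dotZr mulmx_suml dot_sumr.
have Msym y z : dot y (M *m z) = dot (M *m y) z.
  rewrite [RHS]dotC !Mdot; congr (_ * _); apply: eq_bigr => p pp.
  by rewrite projector_sym ?neq_pair // dotC.
have M0 y : 0 <= dot y (M *m y).
  rewrite Mdot mulr_ge0 ?invr_ge0 ?ler0n // sumr_ge0 // => p pp.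
  by rewrite projector_ge0 ?neq_pair.
have Mle c (y : 'cV[R]_n) : c != 0 -> casimir *m y = c *: y ->
    dot (M *m y) (M *m y) <= beta ^+ 2 * dot y y.
  move=> c0; apply: (psd_norm_le (V := casimir_eigen c)) => //.
    exact: MV.
  move=> z Cz; have := eigenspace_gap c0 Cz.
  rewrite sumrB Mdot -(ler_pM2l (x := np%:R^-1)) ?invr_gt0 // mulrBr.
  rewrite (eq_bigr (fun=> 1 * dot z z)) => [|p _]; last by rewrite mul1r.
  rewrite -mulr_suml npE (mulrA _ np%:R) mulVf ?gt_eqF // mul1r.
  rewrite /beta !mulrBl !mul1r; set A := dot z z; set B := _ * \sum_(p | _) _.
  rewrite mulrA (mulrC np%:R^-1) => h; lra.
have [cs ucs roots] := sym_apply_roots casimir_sym.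
have [//|//|//|//|y Hy xy] := @eigen_decomposition _ _ casimir (fun=> True) cs x
  _ _ _ _ ucs I (roots x).
pose L := M - Pi.
have Ly c : L *m y c = if c == 0 then 0 else M *m y c.
  have [_ Cy] := Hy c; rewrite /L mulmxBl; case: eqP Cy => [->|/eqP c0] Cy.
    have Iy : invariant (y 0) by apply: casimir0_invariant; rewrite (Hy 0).2 scale0r.
    by rewrite Minv // Pi1 // subrr.
  rewrite Pi0 ?subr0 // => z /invariant_casimir0 Cz.
  by apply: (eigen_orthogonal casimir_sym c0 Cy); rewrite Cz scale0r.
have CLy c : casimir *m (L *m y c) = c *: (L *m y c).
  rewrite Ly; case: eqP => _; first by rewrite mulmx0 scaler0.
  by apply: MV; case: (Hy c).
have pyth (f : R -> 'cV[R]_n) : (forall c, casimir *m f c = c *: f c) ->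
    dot (\sum_(c <- cs) f c) (\sum_(c <- cs) f c) = \sum_(c <- cs) dot (f c) (f c).
  move=> Cf; rewrite dot_suml big_seq [RHS]big_seq; apply: eq_bigr => c ccs.
  rewrite dot_sumr (bigD1_seq c) //= big1 ?addr0 // => c' cc'.
  by rewrite (eigen_orthogonal casimir_sym _ (Cf c) (Cf c')) // eq_sym.
rewrite -/L xy mulmx_sumr !pyth //; last by move=> c; case: (Hy c).
rewrite mulr_sumr; apply: ler_sum => c _; rewrite Ly.
case: eqP => [_|/eqP c0]; first by rewrite dot0l mulr_ge0 ?sqr_ge0 ?dot_ge0.
by apply: Mle c0 _; case: (Hy c).
Qed.

End Gap.

End Casimir.

(** * Fourier expansion of the tensor powers of a plane rotation *)

Section TensorDerivation.
Variables (R : realType) (N : nat).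

(** The Lie algebra action on the tensor power of order [k + 1], the derivative of [ntensmx_rec] at
    the identity; the shift by one follows the indexing of [ntensmx_rec]. *)
Fixpoint tensder (A : 'M[R]_N) k : 'M[R]_(N ^ k.+1) :=
  if k is k'.+1
  then A *t (1%:M : 'M[R]_(N ^ k'.+1)) + (1%:M : 'M[R]_N) *t tensder A k'
  else A.

Lemma tensderD A B k : tensder (A + B) k = tensder A k + tensder B k.
Proof.
elim: k => //= k ->; apply/matrixP => i j; rewrite !mxE; ring.
Qed.

Lemma tensderZ c A k : tensder (c *: A) k = c *: tensder A k.
Proof.
elim: k => //= k ->; apply/matrixP => i j; rewrite !mxE; ring.
Qed.

Lemma tensderN A k : tensder (- A) k = - tensder A k.
Proof. by rewrite -scaleN1r tensderZ scaleN1r. Qed.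

Lemma tensder_tr A k : tensder A^T k = (tensder A k)^T.
Proof. by elim: k => //= k ->; rewrite linearD /= !trmx_tens !trmx1. Qed.

Lemma tensder_comm A B k :
  tensder A k *m tensder B k - tensder B k *m tensder A k =
  tensder (A *m B - B *m A) k.
Proof.
elim: k => //= k <-; rewrite !mulmxDl !mulmxDr !tensmx_mul !mul1mx !mulmx1.
move: (tensder A k *m _) (tensder B k *m _) (A *m B) (B *m A) => X Y Z T.
apply/matrixP => i j; rewrite !mxE; ring.
Qed.

End TensorDerivation.

Lemma ntensmx_recM (R : realType) (N : nat) (A B : 'M[R]_N) k :
  ntensmx_rec A k *m ntensmx_rec B k = ntensmx_rec (A *m B) k.
Proof. by elim: k => //= k <-; rewrite tensmx_mul. Qed.

Lemma tensmx11 (R : realType) m n : (1%:M : 'M[R]_m) *t (1%:M : 'M[R]_n) = 1%:M.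
Proof.
apply/matrixP => i j; case: (mxtens_indexP i) => i0 i1.
case: (mxtens_indexP j) => j0 j1; rewrite tensmxE !mxE -natrM mulnb.
by rewrite (inj_eq (can_inj (@mxtens_indexK m n))) xpair_eqE.
Qed.

Lemma ntensmx_rec1 (R : realType) (N : nat) k : ntensmx_rec (1%:M : 'M[R]_N) k = 1%:M.
Proof. by elim: k => //= k ->; rewrite tensmx11. Qed.

Lemma ntensmx_rec_tr (R : realType) (N : nat) (A : 'M[R]_N) k :
  ntensmx_rec A^T k = (ntensmx_rec A k)^T.
Proof. by elim: k => //= k ->; rewrite trmx_tens. Qed.

Section TrigExpansion.
Variable R : realType.

(* The Fourier expansion of [th |-> exp (th X)] for a skew-symmetric [X]: [A i] and
   [B i] come from the frequencies [w i] and [- w i]. *)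
Definition trig_expansion n (X : 'M[R]_n) (f : R -> 'M[R]_n) (t : nat)
    (I : finType) (w : I -> int) (A B : I -> 'M[R]_n) :=
  [/\ forall th, f th =
        \sum_i (cos ((w i)%:~R * th) *: A i + sin ((w i)%:~R * th) *: B i),
      forall i, (`|w i| <= t)%N,
      forall i, X *m A i = (w i)%:~R *: B i /\ X *m B i = - (w i)%:~R *: A i &
      forall i, A i *m X = (w i)%:~R *: B i /\ B i *m X = - (w i)%:~R *: A i].

(** Product-to-sum formulas: each pair of frequencies yields their sum and their difference,
    selected by the boolean, and the coefficient matrices combine accordingly. *)
Lemma trig_expansion_tens m n X Y f g s t I J w w' A B A' B' :
  @trig_expansion m X f s I w A B -> @trig_expansion n Y g t J w' A' B' ->
  trig_expansion (X *t (1%:M : 'M[R]_n) + (1%:M : 'M[R]_m) *t Y)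
    (fun th => f th *t g th) (s + t)
    (fun p : I * J * bool => if p.2 then w p.1.1 + w' p.1.2 else w p.1.1 - w' p.1.2)
    (fun p => if p.2 then 2^-1 *: (A p.1.1 *t A' p.1.2 - B p.1.1 *t B' p.1.2)
              else 2^-1 *: (A p.1.1 *t A' p.1.2 + B p.1.1 *t B' p.1.2))
    (fun p => if p.2 then 2^-1 *: (A p.1.1 *t B' p.1.2 + B p.1.1 *t A' p.1.2)
              else 2^-1 *: (B p.1.1 *t A' p.1.2 - A p.1.1 *t B' p.1.2)).
Proof.
move=> [fE ws Xl Xr] [gE wt Yl Yr]; split.
- move=> th; rewrite fE gE.
  pose v (p : I * J) (b : bool) := if b then w p.1 + w' p.2 else w p.1 - w' p.2.
  rewrite -(pair_bigA _ (fun p b => cos ((v p b)%:~R * th) *: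
        (if b then 2^-1 *: (A p.1 *t A' p.2 - B p.1 *t B' p.2)
         else 2^-1 *: (A p.1 *t A' p.2 + B p.1 *t B' p.2)) +
      sin ((v p b)%:~R * th) *:
        (if b then 2^-1 *: (A p.1 *t B' p.2 + B p.1 *t A' p.2)
         else 2^-1 *: (B p.1 *t A' p.2 - A p.1 *t B' p.2)))) /=.
  under [RHS]eq_bigr do rewrite big_bool /=.
  apply/matrixP => i j; rewrite mxE !summxE mulr_suml.
  under eq_bigr do rewrite mulr_sumr.
  rewrite pair_bigA; apply: eq_bigr => -[k l] _ /=.
  rewrite intrD intrB mulrDl mulrBl cosD sinD cosB sinB !mxE.
  by field.
- move=> [[i j] []] /=; rewrite (leq_trans _ (leq_add (ws i) (wt j))) //.
    by rewrite -lez_nat PoszD !abszE ler_normD.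
  by rewrite -lez_nat PoszD !abszE ler_normB.
- move=> [[i j] b] /=; have [XA XB] := Xl i; have [YA YB] := Yl j.
  case: b; split;
    rewrite -!scalemxAr !(mulmxDl, mulmxDr, mulmxN) !tensmx_mul !mul1mx XA XB YA YB;
    apply/matrixP => k l; rewrite !mxE; ring.
- move=> [[i j] b] /=; have [XA XB] := Xr i; have [YA YB] := Yr j.
  case: b; split;
    rewrite -!scalemxAl !(mulmxDl, mulmxDr, mulNmx) !tensmx_mul !mulmx1 XA XB YA YB;
    apply/matrixP => k l; rewrite !mxE; ring.
Qed.

Lemma apply_roots_sum n (S : 'M[R]_n) (r : seq R) (I : finType) (F : I -> 'cV[R]_n) :
  apply_roots S r (\sum_i F i) = \sum_i apply_roots S r (F i).
Proof.
elim: r F => //= c r IH F; rewrite -IH; congr apply_roots.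
by rewrite mulmx_sumr scaler_sumr -sumrB.
Qed.

Lemma apply_roots_eigen n (S : 'M[R]_n) (r : seq R) (c : R) (x : 'cV[R]_n) :
  S *m x = c *: x -> c \in r -> apply_roots S r x = 0.
Proof.
move=> Sx; elim: r x Sx => //= d r IH x Sx; rewrite inE => /predU1P[<-|cr].
  rewrite Sx subrr; elim: r {IH} => //= e r; by rewrite mulmx0 scaler0 subrr.
apply: IH cr; rewrite mulmxBr -scalemxAr Sx -scalemxAr Sx scalerBr !scalerA.
by rewrite (mulrC d).
Qed.

Section Consequences.
Variables (n t : nat) (X : 'M[R]_n) (f : R -> 'M[R]_n).
Variables (I : finType) (w : I -> int) (A B : I -> 'M[R]_n).
Hypothesis fX : trig_expansion X f t w A B.
Hypothesis f0 : f 0 = 1%:M.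

Definition zero_part : 'M[R]_n := \sum_(i | w i == 0) A i.

Let sumA : \sum_i A i = 1%:M.
Proof.
have [fE _ _ _] := fX; rewrite -f0 fE; apply: eq_bigr => i _.
by rewrite mulr0 cos0 sin0 scale1r scale0r addr0.
Qed.

Let wsq i : (w i)%:~R ^+ 2 = (`|w i|%N)%:R ^+ 2 :> R.
Proof. by case: (w i) => k //=; rewrite NegzE rmorphN sqrrN. Qed.

Let SA i : - (X *m X) *m A i = (w i)%:~R ^+ 2 *: A i.
Proof.
have [_ _ Xl _] := fX; have [XA XB] := Xl i.
by rewrite mulNmx -mulmxA XA -scalemxAr XB scalerA mulrN scaleNr opprK.
Qed.

Let AS i : A i *m - (X *m X) = (w i)%:~R ^+ 2 *: A i.
Proof.
have [_ _ _ Xr] := fX; have [XA XB] := Xr i.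
by rewrite mulmxN mulmxA XA -scalemxAl XB scalerA mulrN scaleNr opprK.
Qed.

(** Since [f 0 = 1] the [A i] sum to the identity, and every [A i x] is an eigenvector of [- X^2]
    with eigenvalue [(w i)^2], where [|w i| <= t]. *)
Lemma trig_roots x :
  apply_roots (- (X *m X)) [seq m%:R ^+ 2 | m <- iota 0 t.+1] x = 0.
Proof.
rewrite -[x]mul1mx -sumA mulmx_suml apply_roots_sum big1 // => i _.
apply: (@apply_roots_eigen _ _ _ ((w i)%:~R ^+ 2)).
  by rewrite mulmxA SA scalemxAl.
rewrite wsq; apply/mapP; exists `|w i|%N => //.
by rewrite mem_iota /= add0n ltnS; have [] := fX.
Qed.

(** Comparing [A i (- X^2) x] computed on either side shows that [A i] kills a vector of weight [m]
    unless [|w i| = m]. *)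
Lemma zero_partE m (x : 'cV[R]_n) : - (X *m X) *m x = m%:R ^+ 2 *: x ->
  zero_part *m x = (m == 0%N)%:R *: x.
Proof.
move=> Sx; have A0 i : (w i)%:~R ^+ 2 != m%:R ^+ 2 :> R -> A i *m x = 0.
  move=> wm; apply/eqP; have /eqP : A i *m (- (X *m X) *m x) = A i *m (- (X *m X) *m x) by [].
  rewrite {1}mulmxA AS Sx -scalemxAl -scalemxAr -subr_eq0 -scalerBl.
  by rewrite scaler_eq0 subr_eq0 (negPf wm).
have wm0 i : ((w i)%:~R ^+ 2 == 0 :> R) = (w i == 0) by rewrite sqrf_eq0 intr_eq0.
rewrite /zero_part mulmx_suml; case: eqP => [m0|/eqP m0].
  rewrite scale1r -[RHS]mul1mx -sumA mulmx_suml [RHS](bigID (fun i => w i == 0)) /=.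
  rewrite [X in _ = _ + X]big1 ?addr0 // => i wi; apply: A0.
  by rewrite m0 expr0n /= wm0.
rewrite scale0r big1 // => i /eqP wi; apply: A0.
by rewrite wi expr0n /= eq_sym sqrf_eq0 pnatr_eq0.
Qed.

(** If [X x = 0], the right-hand relations force [A i x = B i x = 0] at every nonzero frequency, so
    only the constant terms remain. *)
Lemma trig_invariant (x : 'cV[R]_n) th : X *m x = 0 -> f th *m x = x.
Proof.
move=> Xx; have [fE _ _ Xr] := fX.
rewrite fE -[RHS]mul1mx -sumA !mulmx_suml; apply: eq_bigr => i _.
have [XA XB] := Xr i; have [wi|wi] := eqVneq (w i) 0.
  by rewrite wi mul0r cos0 sin0 scale1r scale0r addr0.
have wr : (w i)%:~R != 0 :> R by rewrite intr_eq0.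
have Bx : B i *m x = 0.
  by apply: (scalerI wr); rewrite scalemxAl -XA -mulmxA Xx mulmx0 scaler0.
have Ax : A i *m x = 0.
  apply: (scalerI (a := - (w i)%:~R)); first by rewrite oppr_eq0.
  by rewrite scalemxAl -XB -mulmxA Xx mulmx0 scaler0.
by rewrite mulmxDl -!scalemxAl Ax Bx !scaler0 addr0.
Qed.

Lemma zero_part_ker : X *m zero_part = 0.
Proof.
have [_ _ Xl _] := fX; rewrite mulmx_sumr big1 // => i /eqP wi.
by rewrite (Xl i).1 wi scale0r.
Qed.

End Consequences.

End TrigExpansion.

Section Rotation.
Variables (R : realType) (N : nat).
Implicit Types a b c d : 'I_N.

Local Notation E := (@Emx R N).

Lemma Emx_comm a b c d : E a b *m E c d - E c d *m E a b =
  (b == c)%:R *: E a d - (a == c)%:R *: E b d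
  - (b == d)%:R *: E a c + (a == d)%:R *: E b c.
Proof.
rewrite /Emx !mulmxBl !mulmxBr !mul_delta_mx_cond !scaler_nat !mulrnBl.
rewrite (eq_sym d a) (eq_sym d b) (eq_sym c a) (eq_sym c b).
by apply/matrixP => i j; rewrite !(mxE, mulmxnE); ring.
Qed.

Lemma Emx_anti a b : E b a = - E a b.
Proof. by rewrite /Emx opprB. Qed.

Lemma Emx_tr a b : (E a b)^T = - E a b.
Proof. by rewrite /Emx linearB /= !trmx_delta opprB. Qed.

Lemma Emx_sqr a b : a != b ->
  E a b *m E a b = - (delta_mx a a + delta_mx b b).
Proof.
move=> ab; rewrite /Emx !mulmxBl !mulmxBr !mul_delta_mx_cond !eqxx.
by rewrite (eq_sym b) (negPf ab) !mulr0n !mulr1n sub0r subr0 opprD.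
Qed.

Lemma Emx_cube a b : a != b -> E a b *m E a b *m E a b = - E a b.
Proof.
move=> ab; rewrite Emx_sqr // mulNmx; congr (- _).
rewrite /Emx mulmxDl !mulmxBr !mul_delta_mx_cond !eqxx.
by rewrite (eq_sym b) (negPf ab) !mulr0n !mulr1n subr0 sub0r.
Qed.

(** Rodrigues' formula for the exponential of an angle times [E], based on [E^3 = - E]. Cosine and
    sine are free parameters so that elimination can choose them from matrix entries. *)
Definition planerot a b (co si : R) : 'M[R]_N :=
  1%:M + si *: E a b + (1 - co) *: (E a b *m E a b).

Lemma rot_trig_expansion a b : a != b ->
  trig_expansion (E a b) (fun th => planerot a b (cos th) (sin th)) 1
    (fun i : bool => if i then 1 else 0)
    (fun i => if i then - (E a b *m E a b) else 1%:M + E a b *m E a b)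
    (fun i => if i then E a b else 0).
Proof.
move=> ab; split=> [th|[]|[]|[]] //.
- rewrite big_bool /= mul1r mul0r cos0 sin0 /planerot.
  by move: (_ *m _) => F; apply/matrixP => i j; rewrite !mxE; ring.
- by rewrite mulmxN mulmxA Emx_cube // opprK scale1r scaleN1r opprK.
- by rewrite mulmxDr mulmx1 mulmxA Emx_cube // subrr mulmx0 oppr0 !scale0r.
- by rewrite mulNmx Emx_cube // opprK scale1r scaleN1r opprK.
- by rewrite mulmxDl mul1mx Emx_cube // subrr mul0mx oppr0 !scale0r.
Qed.

Lemma tensrot_trig_expansion a b k : a != b ->
  exists (I : finType) (w : I -> int) (A B : I -> 'M[R]_(N ^ k.+1)),
    trig_expansion (tensder (E a b) k)
      (fun th => ntensmx_rec (planerot a b (cos th) (sin th)) k) k.+1 w A B.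
Proof.
move=> ab; elim: k => [|k [I [w [A [B IH]]]]].
  by do 4!eexists; apply: rot_trig_expansion.
do 4!eexists; exact: (trig_expansion_tens (rot_trig_expansion ab) IH).
Qed.

Lemma planerot10 a b : planerot a b 1 0 = 1%:M.
Proof. by rewrite /planerot subrr !scale0r !addr0. Qed.

End Rotation.

(** * Plane rotations generate the special orthogonal group *)

Lemma circle_angle (R : realType) (co si : R) : co ^+ 2 + si ^+ 2 = 1 ->
  exists th, co = cos th /\ si = sin th.
Proof.
move=> cs.
have co1 : -1 <= co <= 1.
  by have := sqr_ge0 si; apply: contraTT; rewrite negb_and -!ltNge => /orP[]; nra.
have cE : cos (acos co) = co by apply: acosK; rewrite in_itv.
have sE : sin (acos co) = `|si|.
  by rewrite sin_acos // -cs addrC addKr sqrtr_sqr.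
have [si0|si0] := leP 0 si.
  by exists (acos co); rewrite cE sE ger0_norm.
by exists (- acos co); rewrite cosN sinN cE sE ltr0_norm // opprK.
Qed.

Section Generation.
Variables (R : realType) (N : nat).
Implicit Types (a b : 'I_N) (Q : 'M[R]_N).

Lemma planerot_mul a b (c1 s1 c2 s2 : R) : a != b ->
  planerot a b c1 s1 *m planerot a b c2 s2 =
  planerot a b (c1 * c2 - s1 * s2) (s1 * c2 + c1 * s2).
Proof.
move=> ab; rewrite /planerot; have := Emx_cube R ab.
set E := Emx _ _ _; set E2 := E *m E => E3.
have E3' : E *m E2 = - E by rewrite mulmxA.
have E4 : E2 *m E2 = - E2 by rewrite mulmxA E3 mulNmx.
rewrite !(mulmxDl, mulmxDr) !mulmx1 !mul1mx -!(scalemxAl, scalemxAr) E3 E3' E4 -/E2.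
by apply/matrixP => i j; rewrite !mxE; ring.
Qed.

Lemma planerot_tr a b (co si : R) : (planerot a b co si)^T = planerot a b co (- si).
Proof.
rewrite /planerot; have := Emx_tr R a b; move: (Emx R a b) => E Et.
rewrite !linearD /= !linearZ /= trmx_mul trmx1 Et.
by rewrite mulNmx mulmxN opprK scalerN scaleNr.
Qed.

Lemma planerot_orth a b (co si : R) : a != b -> co ^+ 2 + si ^+ 2 = 1 ->
  (planerot a b co si)^T *m planerot a b co si = 1%:M.
Proof.
move=> ab cs; rewrite planerot_tr planerot_mul // -(planerot10 R a b).
by congr planerot; [rewrite -cs|]; ring.
Qed.

(* A plane rotation is the square of the rotation by half the angle. *)
Lemma det_planerot a b (co si : R) : a != b -> co ^+ 2 + si ^+ 2 = 1 ->
  \det (planerot a b co si) = 1.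
Proof.
move=> ab /circle_angle[th [-> ->]].
pose h := planerot a b (cos (th / 2)) (sin (th / 2)).
have -> : planerot a b (cos th) (sin th) = h *m h.
  by rewrite planerot_mul // -cosD -sinD -splitr.
have := congr1 determinant (planerot_orth ab (cos2Dsin2 (th / 2))).
by rewrite !det_mulmx det_tr det1.
Qed.

Lemma delta_mulmxE a b Q r i : (delta_mx a b *m Q) r i = (r == a)%:R * Q b i.
Proof.
rewrite mxE (bigD1 b) //= big1 ?addr0 => [|k kb]; rewrite mxE ?eqxx ?andbT //.
by rewrite (negPf kb) andbF mul0r.
Qed.

Lemma planerot_mulE a b (co si : R) Q r i : a != b ->
  (planerot a b co si *m Q) r i =
  Q r i + si * ((r == a)%:R * Q b i - (r == b)%:R * Q a i)
  - (1 - co) * ((r == a)%:R * Q a i + (r == b)%:R * Q b i).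
Proof.
move=> ab; rewrite /planerot Emx_sqr // !mulmxDl mul1mx -!scalemxAl /Emx.
rewrite mulmxBl mulNmx mulmxDl !(delta_mulmxE, mxE).
by rewrite -!delta_mulmxE !mxE; ring.
Qed.

Definition fixes_cols (j : nat) Q :=
  forall i : 'I_N, (i < j)%N -> forall r, Q r i = (r == i)%:R.

(** Column [i] is a basis vector, so its inner product with column [k] is just the entry [Q i k];
    orthonormality of the columns gives its value. *)
Lemma SOmx_fixed_row j Q (i k : 'I_N) : Q^T *m Q = 1%:M -> fixes_cols j Q ->
  (i < j)%N -> Q i k = (i == k)%:R.
Proof.
move=> Qo Qf ij; have /matrixP/(_ i k) := Qo.
rewrite !mxE (bigD1 i) //= mxE Qf // eqxx mul1r big1 ?addr0 // => r ri.
by rewrite mxE Qf // (negPf ri) mul0r.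
Qed.

Variable F : 'M[R]_N -> Prop.
Hypothesis F1 : F 1%:M.
Hypothesis FM : forall A B, F A -> F B -> F (A *m B).
Hypothesis Frot : forall a b (co si : R), a != b -> co ^+ 2 + si ^+ 2 = 1 ->
  F (planerot a b co si).

(** Givens elimination below the diagonal. Each rotation mixes only rows [j] and [b], so the zeros
    already created in other rows of [bs] survive, and it makes the diagonal entry a norm, hence
    nonnegative. *)
Lemma clear_column (j : 'I_N) (bs : seq 'I_N) Q :
    {in bs, forall b : 'I_N, (j < b)%N} -> SOmx Q -> fixes_cols j Q ->
  exists Q', [/\ SOmx Q', fixes_cols j Q', F Q' -> F Q,
    {in bs, forall b, Q' b j = 0} & bs != [::] -> 0 <= Q' j j].
Proof.
elim: bs => [|b bs IH] jb SQ fQ; first by exists Q; split.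
have [|P [[Po Pd] fP FP P0 Pge]] := IH _ SQ fQ.
  by move=> c cbs; apply: jb; rewrite inE cbs orbT.
have jltb : (j < b)%N by apply: jb; rewrite inE eqxx.
have jnb : j != b by rewrite -val_eqE neq_ltn jltb.
pose p := P j j; pose q := P b j; pose r := Num.sqrt (p ^+ 2 + q ^+ 2).
have r2 : r ^+ 2 = p ^+ 2 + q ^+ 2 by rewrite sqr_sqrtr // addr_ge0 ?sqr_ge0.
have [r0|r0] := eqVneq r 0.
  have : p ^+ 2 + q ^+ 2 == 0 by rewrite -r2 r0 expr0n.
  rewrite paddr_eq0 ?sqr_ge0 // !sqrf_eq0 => /andP[/eqP p0 /eqP q0].
  exists P; split=> // [c|_]; last by rewrite -/p p0.
  by rewrite inE => /predU1P[->|/P0].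
pose co := p / r; pose si := q / r.
have cs : co ^+ 2 + si ^+ 2 = 1.
  by rewrite /co /si !expr_div_n -mulrDl -r2 divff // expf_neq0.
have cs' : co ^+ 2 + (- si) ^+ 2 = 1 by rewrite sqrrN.
exists (planerot j b co si *m P); split.
- split; last by rewrite det_mulmx det_planerot // Pd mulr1.
  by rewrite trmx_mul -mulmxA (mulmxA _ _ P) planerot_orth // mul1mx.
- move=> i ij s; have ib := ltn_trans ij jltb.
  have Pj : P j i = 0 by rewrite fP // -val_eqE gtn_eqF.
  have Pb : P b i = 0 by rewrite fP // -val_eqE gtn_eqF.
  by rewrite planerot_mulE // Pj Pb !mulr0 addr0 subr0 !mulr0 addr0 subr0 fP.
(* The step is undone by the inverse rotation, with sine [- si], which also satisfies [F]. *)
- move=> /(FM (Frot jnb cs')); rewrite mulmxA -planerot_tr planerot_orth //.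
  by rewrite mul1mx => /FP.
- move=> c; rewrite planerot_mulE // inE => cb.
  have [->|cnb] := eqVneq c b.
    rewrite (eq_sym b) (negPf jnb) -/p -/q /= mulr0n mulr1n.
    by rewrite /co /si; field.
  have {cb}cbs : c \in bs by case/predU1P: cb cnb => [->|//]; rewrite eqxx.
  have cj : (c == j) = false.
    by apply/negP => /eqP cj; have := jb c; rewrite inE cbs orbT cj ltnn => /(_ isT).
  by rewrite cj P0 // !(mul0r, subr0, addr0, mulr0).
- move=> _; rewrite planerot_mulE // eqxx (negPf jnb) -/p -/q /= mulr0n mulr1n.
  suff -> : p + si * (1 * q - 0 * p) - (1 - co) * (1 * p + 0 * q) = r.
    exact: sqrtr_ge0.
  transitivity ((p ^+ 2 + q ^+ 2) / r); first by rewrite /co /si; field.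
  by rewrite -r2 expr2 mulfK.
Qed.

(** Generation is phrased as an induction principle: any multiplicative property of plane rotations
    holds on SO(N). Columns are reduced to those of the identity from left to right. *)
Lemma SOmx_generated Q : SOmx Q -> F Q.
Proof.
suff H m j : (j + m = N)%N -> forall Q, SOmx Q -> fixes_cols j Q -> F Q.
  by move=> SQ; apply: (H N 0%N).
elim: m j => [|m IH] j jN {}Q SQ fQ.
  suff -> : Q = 1%:M by [].
  by apply/matrixP => i k; rewrite fQ ?mxE // -[j]addn0 jN ltn_ord.
have jlt : (j < N)%N by rewrite -jN addnS ltnS leq_addr.
pose jo := Ordinal jlt.
have [|P [SP fP FP P0 Pge]] :=
  @clear_column jo [seq b : 'I_N <- enum 'I_N | (j < b)%N] Q _ SQ fQ.
  by move=> b; rewrite mem_filter => /andP[].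
apply: FP; have [Po Pd] := SP.
have Poff r : r != jo -> P r jo = 0.
  move=> rj; have [rlt|jr|rjo] := ltngtP r j; last by case/eqP: rj; apply: val_inj.
    by rewrite (SOmx_fixed_row jo Po fP rlt) (negPf rj).
  by apply: P0; rewrite mem_filter jr mem_enum.
have Psq : P jo jo ^+ 2 = 1.
  have /matrixP/(_ jo jo) := Po; rewrite !mxE eqxx (bigD1 jo) //= mxE big1 ?addr0 //.
  by move=> r rj; rewrite mxE Poff ?mul0r.
(* The entry is 1 or -1. If rows remain below, elimination has made it nonnegative; in the last
   column nothing can be eliminated, and the determinant fixes the sign. *)
have Pjj : P jo jo = 1.
  have [jm|jm] := eqVneq m 0%N; last first.
    have /Pge : [seq b : 'I_N <- enum 'I_N | (j < b)%N] != [::].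
      have jlt' : (j.+1 < N)%N.
        by rewrite -jN addnS ltnS -[X in (X < _)%N]addn0 ltn_add2l lt0n.
      rewrite -has_filter; apply/hasP; exists (Ordinal jlt'); rewrite ?mem_enum //=.
    move=> ge0; apply/eqP; have /eqP := Psq; rewrite sqrf_eq1 => /orP[//|/eqP Pm].
    by move: ge0; rewrite Pm ler0N1.
  have trig i k : i != k -> P i k = 0.
    move=> ik; have [klt|kge] := ltnP k j; first by rewrite fP // (negPf ik).
    have kj : k = jo.
      apply/val_inj/eqP; rewrite eqn_leq /= kge andbT -ltnS.
      by move: jN; rewrite jm addn1 => ->.
    by rewrite kj Poff // -kj.
  move: Pd; rewrite det_trig; last first.
    by apply/is_trig_mxP => i k ik; rewrite trig // neq_ltn ik.
  rewrite (bigD1 jo) //= big1 ?mulr1 // => i ij.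
  have ilt : (i < j)%N.
    rewrite ltn_neqAle -(inj_eq val_inj) in ij *; rewrite ij /= -ltnS.
    by move: jN; rewrite jm addn1 => ->.
  by rewrite fP // eqxx.
apply: (IH j.+1) SP _; first by rewrite addSnnS.
move=> i; rewrite ltnS leq_eqVlt => /predU1P[ij|ij] r; last exact: fP.
have -> : i = jo by apply: val_inj.
by case: eqVneq => [->|/Poff].
Qed.

End Generation.

(** * Exponentials and integrals *)

Section Exponential.
Variables (R : realType) (N : nat).

(** Powers of [E] repeat with period four up to the exponent 0, where the identity replaces [- E^2];
    the last summand corrects for this. The coefficients have the shape of [cos_coeff] and
    [sin_coeff]. *)
Lemma expr_Emx (a b : 'I_N) (th : R) k : a != b ->
  (th *: Emx R a b) ^+ k =
  th ^+ k *: (((~~ odd k)%:R * (-1) ^+ k./2) *: - (Emx R a b *m Emx R a b) +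
              ((odd k)%:R * (-1) ^+ k.-1./2) *: Emx R a b +
              (k == 0%N)%:R *: (1%:M + Emx R a b *m Emx R a b)).
Proof.
move=> ab; have := Emx_cube R ab; move: (Emx R a b) => E.
move E2E : (E *m E) => E2 E3.
have E3' : E *m E2 = - E by rewrite -E2E mulmxA E2E.
elim: k => [|k IH].
  by rewrite !expr0 /= !mul0r mul1r scale0r !scale1r addr0 addrC addrK.
rewrite exprS IH -[_ * _]/(_ *m _) -scalemxAl -scalemxAr scalerA -exprS.
congr (_ *: _); rewrite !mulmxDr -!scalemxAr.
rewrite mulmxN E3' mulmxDr mulmx1 E3' E2E.
rewrite subrr !scaler0 addr0 opprK scale0r addr0 /=.
case: (boolP (odd k)) => kodd /=; rewrite ?mul0r ?scale0r ?add0r ?addr0 !mul1r.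
  by case: k kodd {IH} =>  //= k _; rewrite exprS mulN1r scaleNr scalerN opprK.
by [].
Qed.

Lemma expm_Emx (a b : 'I_N) (th : R) : a != b ->
  expm (th *: Emx R a b) = planerot a b (cos th) (sin th).
Proof.
move=> ab; rewrite /expm; apply: cvg_lim; first exact: norm_hausdorff.
pose E := Emx R a b; pose E2 := E *m E.
(* The factor [(0 < n)%N%:R] accounts for the empty partial sum, which lacks the exponent-zero
   correction. *)
have -> : series (fun k : nat => (k`!%:R)^-1 *: (th *: Emx R a b) ^+ k) =
    (fun n => series (cos_coeff th) n *: - E2 + series (sin_coeff th) n *: E
        + (0 < n)%N%:R *: (1%:M + E2)).
  apply/funext => n; elim: n => [|n IH].
    by rewrite /series /= !big_geq // !scale0r !addr0.
  rewrite seriesSr IH !seriesSr expr_Emx // -/E -/E2 /cos_coeff /sin_coeff /= -?exprnP.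
  move: (series _ _) (series _ _) => s s'.
  case: n {IH} => [|n] /=; last first.
    by apply/matrixP => i j; rewrite !mxE; ring.
  by rewrite !expr0 fact0 invr1; apply/matrixP => i j; rewrite !mxE; ring.
have -> : planerot a b (cos th) (sin th) =
    cos th *: - E2 + sin th *: E + 1 *: (1%:M + E2).
  by rewrite /planerot -/E -/E2; apply/matrixP => i j; rewrite !mxE; ring.
apply: cvgD; first apply: cvgD.
- apply: cvgZr_tmp.
  by rewrite unlock; exact: is_cvg_series_cos_coeff.
- by apply: cvgZr_tmp; rewrite unlock; exact: is_cvg_series_sin_coeff.
apply: cvgZr_tmp; apply: cvg_near_cst; near=> n.
by rewrite (_ : (0 < n)%N = true) //; near: n; exists 1%N.
Unshelve. all: end_near.
Qed.

End Exponential.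

Section RintegralSum.
Variables (d : measure_display) (T : measurableType d) (R : realType).
Variables (mu : {measure set T -> \bar R}) (D : set T).
Hypothesis mD : measurable D.

Lemma Rintegral_lincomb (I : Type) (r : seq I) (c : I -> R) (h : I -> T -> R) :
    (forall i, mu.-integrable D (EFin \o h i)) ->
  mu.-integrable D (EFin \o (fun x => \sum_(i <- r) c i * h i x)) /\
  Rintegral mu D (fun x => \sum_(i <- r) c i * h i x) =
  \sum_(i <- r) c i * Rintegral mu D (h i).
Proof.
move=> ih; elim: r => [|i r [IH1 IH2]].
  under [X in EFin \o X]eq_fun do rewrite big_nil.
  under eq_Rintegral do rewrite big_nil.
  by split; [exact: integrable0 | rewrite big_nil Rintegral_cst // mul0r].
have ci : mu.-integrable D (EFin \o (fun x => c i * h i x)).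
  exact: (integrableZl mD (c i) (ih i)).
under [X in EFin \o X]eq_fun do rewrite big_cons.
under eq_Rintegral do rewrite big_cons.
split; first exact: (integrableD mD ci IH1).
by rewrite big_cons RintegralD // RintegralZl // IH2.
Qed.

End RintegralSum.

(** * Integrals of trigonometric sums over a full period *)

Section TrigIntegral.
Variable R : realType.
Let mu := @lebesgue_measure R.

Lemma Rintegral_oo_FTC (f F : R -> R) (a b : R) : a < b ->
  (forall x : R, is_derive x (1 : R) F (f x)) -> continuous f ->
  mu.-integrable `]a, b[ (EFin \o f) /\ Rintegral mu `]a, b[ f = F b - F a.
Proof.
move=> ab Ff cf.
have cF : continuous F.
  by move=> x; apply/differentiable_continuous/derivable1_diffP; case: (Ff x).
have fab : mu.-integrable `[a, b] (EFin \o f).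
  apply: continuous_compact_integrable; first exact: segment_compact.
  exact: continuous_subspaceT.
split.
  by apply: integrableS fab => //; apply: subset_itvW.
rewrite /Rintegral -(@integral_itv_bndoo _ _ _ _ true false) //; last first.
  by apply/measurable_EFinP; apply: measurable_funTS; exact: continuous_measurable_fun.
rewrite (@continuous_FTC2 _ f F) //.
- exact: continuous_subspaceT.
- split.
  + by move=> x _; case: (Ff x).
  + by apply: cvg_at_right_filter; exact: cF.
  + by apply: cvg_at_left_filter; exact: cF.
- by move=> x _; rewrite derive1E; apply: derive_val.
Qed.

Lemma is_derive_scaled (f : R -> R) (c x df : R) :
  is_derive (c * x) (1 : R) f df -> is_derive x (1 : R) (fun y => f (c * y)) (c * df).
Proof.
move=> fd; have cd : is_derive x (1 : R) (fun y : R => c * y) c.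
  by apply: is_derive_eq; rewrite /GRing.scale /= mulr1.
by rewrite mulrC; apply: (@is_derive1_comp _ f (fun y => c * y) x).
Qed.

Lemma continuous_scaled (f : R -> R) (c : R) : continuous f ->
  continuous (fun y => f (c * y)).
Proof.
move=> cf x; apply: (@continuous_comp _ _ _ (fun y => c * y) f); last exact: cf.
exact: mulrl_continuous.
Qed.

Let pi_lt : - pi < pi :> R.
Proof. by have := pi_gt0 R; lra. Qed.

Lemma sin_natpi k : sin (pi *+ k) = 0 :> R.
Proof.
by elim: k => [|k IH]; rewrite ?mulr0n ?sin0 // mulrSr sinDpi IH oppr0.
Qed.

Lemma Rintegral_cos (w : int) :
  mu.-integrable `]- pi, pi[ (EFin \o (fun x => cos (w%:~R * x))) /\
  Rintegral mu `]- pi, pi[ (fun x => cos (w%:~R * x)) = (w == 0)%:R * (2 * pi).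
Proof.
have [->|w0] := eqVneq w 0.
  have [||Hi He] := @Rintegral_oo_FTC (fun x => cos (0%:~R * x)) id _ _ pi_lt.
  - move=> x; rewrite mul0r cos0; exact: is_derive_id.
  - by apply: continuous_scaled; exact: continuous_cos.
  - by rewrite He; split=> //; rewrite opprK mul1r mulr_natl mulr2n.
have wr : w%:~R != 0 :> R by rewrite intr_eq0.
have [||Hi He] := @Rintegral_oo_FTC (fun x => cos (w%:~R * x))
  (fun x => w%:~R^-1 * sin (w%:~R * x)) _ _ pi_lt.
- move=> x; have H := is_derive_scaled (is_derive_sin (w%:~R * x)).
  by apply: is_derive_eq; rewrite /GRing.scale /= mulrA mulVf // mul1r.
- by apply: continuous_scaled; exact: continuous_cos.
- rewrite He; split=> //; rewrite mul0r mulrN sinN.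
  have s0 : sin (w%:~R * pi) = 0 :> R.
    clear; case: w => k; rewrite ?NegzE ?mulrNz ?mulNr ?sinN;
    by rewrite -pmulrn mulr_natl sin_natpi ?oppr0.
  by rewrite s0 oppr0 mulr0 subr0.
Qed.

Lemma Rintegral_sin (w : int) :
  mu.-integrable `]- pi, pi[ (EFin \o (fun x => sin (w%:~R * x))) /\
  Rintegral mu `]- pi, pi[ (fun x => sin (w%:~R * x)) = 0.
Proof.
have [->|w0] := eqVneq w 0.
  have [||Hi He] := @Rintegral_oo_FTC (fun x => sin (0%:~R * x)) (cst 0) _ _ pi_lt.
  - move=> x; rewrite mul0r sin0; exact: is_derive_cst.
  - by apply: continuous_scaled; exact: continuous_sin.
  - by rewrite He; split=> //; rewrite subrr.
have wr : w%:~R != 0 :> R by rewrite intr_eq0.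
have [||Hi He] := @Rintegral_oo_FTC (fun x => sin (w%:~R * x))
  (fun x => - w%:~R^-1 * cos (w%:~R * x)) _ _ pi_lt.
- move=> x; have H := is_derive_scaled (is_derive_cos (w%:~R * x)).
  by apply: is_derive_eq; rewrite /GRing.scale /= mulrA mulNr mulVf // mulrNN mul1r.
- by apply: continuous_scaled; exact: continuous_sin.
- by rewrite He; split=> //; rewrite mulrN cosN subrr.
Qed.

Lemma Rintegral_trig (I : finType) (w : I -> int) (a b : I -> R) :
  Rintegral mu `]- pi, pi[ (fun th =>
     \sum_i (a i * cos ((w i)%:~R * th) + b i * sin ((w i)%:~R * th))) =
  2 * pi * \sum_(i | w i == 0) a i.
Proof.
pose c (p : I * bool) := if p.2 then a p.1 else b p.1.
pose h (p : I * bool) (th : R) :=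
  if p.2 then cos ((w p.1)%:~R * th) else sin ((w p.1)%:~R * th).
have E : (fun th => \sum_i (a i * cos ((w i)%:~R * th) + b i * sin ((w i)%:~R * th))) =
   (fun th => \sum_(p : I * bool) c p * h p th).
  apply/funext => th; rewrite -(pair_bigA _ (fun i b0 => c (i, b0) * h (i, b0) th)) /=.
  by apply: eq_bigr => i _; rewrite big_bool.
rewrite E.
rewrite (Rintegral_lincomb _ _ _ _).2 //; last first.
  by move=> [i []]; rewrite /h /=; [exact: (Rintegral_cos _).1|exact: (Rintegral_sin _).1].
rewrite -(pair_bigA _ (fun i b0 => c (i, b0) * Rintegral mu _ (h (i, b0)))) /=.
rewrite mulr_sumr [RHS]big_mkcond; apply: eq_bigr => i _.
rewrite big_bool /c /h /= (Rintegral_cos _).2 (Rintegral_sin _).2 mulr0 addr0.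
by case: eqP => _; rewrite ?mul1r ?mul0r ?mulr0 // mulrC.
Qed.

End TrigIntegral.

(** * The two averages *)

Section RotationAverage.
Variables (R : realType) (N k : nat).
Let mu := @lebesgue_measure R.

Definition rot_proj (a b : 'I_N) : 'M[R]_(N ^ k.+1) :=
  \matrix_(i, j) ((2 * pi)^-1 * Rintegral mu `]- pi, pi[
     (fun th : R => ntensmx_rec (expm (th *: Emx R a b)) k i j)).

Section Pair.
Variables (a b : 'I_N).
Hypothesis ab : a != b.
Variables (I : finType) (w : I -> int) (A B : I -> 'M[R]_(N ^ k.+1)).
Let X := tensder (Emx R a b) k.
Let f := fun th => ntensmx_rec (planerot a b (cos th) (sin th)) k : 'M[R]_(N ^ k.+1).
Hypothesis fX : trig_expansion X f k.+1 w A B.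

Let pi2 : 2 * pi != 0 :> R.
Proof. by rewrite mulf_neq0 ?pnatr_eq0 // gt_eqF // pi_gt0. Qed.

Lemma rot_projE : rot_proj a b = zero_part w A.
Proof.
apply/matrixP => i j; rewrite !mxE summxE.
have [fE _ _ _] := fX.
rewrite (_ : (fun th : R => _) = fun th => \sum_l
    (A l i j * cos ((w l)%:~R * th) + B l i j * sin ((w l)%:~R * th))); last first.
  apply/funext => th; rewrite expm_Emx // -/(f th) fE summxE.
  by apply: eq_bigr => l _; rewrite !mxE mulrC [X in _ + X]mulrC.
by rewrite Rintegral_trig mulrA mulVf // mul1r.
Qed.

(** Averaging [f th y = y] over the circle gives [zero_part y = y], and [X] annihilates the range of
    [zero_part]. This replaces differentiation at [th = 0]. *)
Lemma fixed_tensder0 (y : 'cV[R]_(N ^ k.+1)) :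
  (forall th, f th *m y = y) -> X *m y = 0.
Proof.
move=> fy; suff <- : zero_part w A *m y = y.
  by rewrite mulmxA (zero_part_ker fX) mul0mx.
have [fE _ _ _] := fX.
apply/matrixP => i j; rewrite ord1 /zero_part mulmx_suml summxE.
apply: (mulfI pi2); rewrite -(Rintegral_trig w _ (fun l => (B l *m y) i 0)).
(* The constant [y i 0] is integrated as a trigonometric sum with the single frequency 0. *)
have := Rintegral_trig (fun _ : unit => 0) (fun=> y i 0) (fun=> 0).
rewrite (big_pred1 tt) => [<-|[]//]; congr Rintegral; apply/funext => th.
rewrite (big_pred1 tt) => [|[]//]; rewrite mul0r cos0 sin0 mulr1 mulr0 addr0.
rewrite -[in RHS](fy th) fE mulmx_suml summxE; apply: eq_bigr => l _.
by rewrite mulmxDl -!scalemxAl !mxE mulrC [X in _ + X]mulrC.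
Qed.

End Pair.

Lemma ntensmx_planerot0 (a b : 'I_N) :
  ntensmx_rec (planerot a b (cos 0) (sin 0)) k = 1%:M :> 'M[R]_(N ^ k.+1).
Proof. by rewrite cos0 sin0 planerot10 ntensmx_rec1. Qed.

Lemma rot_avgE : rot_avg R N k.+1 =
  #|pairs N|%:R^-1 *: \sum_(p : 'I_N * 'I_N | (p.1 < p.2)%N) rot_proj p.1 p.2.
Proof.
apply/matrixP => i j; rewrite !mxE summxE; congr (_ * _).
apply: eq_big => [p|p _]; first by rewrite inE.
by rewrite mxE.
Qed.

End RotationAverage.

(** * Invariance properties of the Haar average *)

Section Haar.
Variables (R : realType) (N k : nat).
Variables (d : measure_display) (T : measurableType d) (P : probability T R).
Variables (O : T -> 'M[R]_N).
Hypothesis hO : haarSO P O.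

(** The generators of [mx_borel]. Through [MT] they make matrices a measurable type, so that the law
    of [O] can be formed as a pushforward. *)
Let G : set (set 'M[R]_N) := [set A | exists (i j : 'I_N) (B : set R),
  measurable B /\ A = [set M : 'M[R]_N | B (M i j)]].
Let MT := g_sigma_algebraType G.

Lemma measurable_entry i j : measurable_fun setT (fun M : MT => M i j).
Proof.
move=> _ B mB; rewrite setTI; apply: sub_sigma_algebra.
by exists i, j, B.
Qed.

Lemma measurable_ntensmx i j :
  measurable_fun setT (fun M : MT => ntensmx_rec M k i j).
Proof.
elim: k i j => [|l IH] i j /=; first exact: measurable_entry.
under eq_fun do rewrite mxE.
by apply: measurable_funM; [exact: measurable_entry | exact: IH].
Qed.

Lemma measurable_matrix (f : T -> MT) :
  (forall i j, measurable_fun setT (fun w => f w i j)) -> measurable_fun setT f.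
Proof.
move=> mf; apply: (@measurability _ _ _ MT setT f G) => //.
by move=> _ [_ [i [j [B [mB ->]]]] <-]; apply: mf.
Qed.

Lemma orthmx_entry_le1 (Q : 'M[R]_N) i j : Q^T *m Q = 1%:M -> `|Q i j| <= 1.
Proof.
move=> /matrixP/(_ j j); rewrite !mxE eqxx (bigD1 i) //= mxE => Q1.
rewrite -(@ler_pXn2r _ 2) ?nnegrE // expr1n real_normK ?num_real // -[X in _ <= X]Q1.
by rewrite expr2 lerDl sumr_ge0 // => r _; rewrite mxE -expr2 sqr_ge0.
Qed.

(** This uniform bound is what makes the entries of the tensor power integrable. *)
Lemma ntensmx_entry_le1 (Q : 'M[R]_N) i j : Q^T *m Q = 1%:M ->
  `|ntensmx_rec Q k i j| <= 1.
Proof.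
move=> Qo; elim: k i j => [|l IH] i j /=; first exact: orthmx_entry_le1.
by rewrite mxE normrM mulr_ile1 // orthmx_entry_le1.
Qed.

Let mO : measurable_fun setT (O : T -> MT).
Proof. by apply: measurable_matrix; have [] := hO. Qed.

Let fine_probT : fine ((P : {measure set T -> \bar R}) setT) = 1 :> R.
Proof. exact: (congr1 fine (probability_setT P)). Qed.

Lemma SOmxM (U V : 'M[R]_N) : SOmx U -> SOmx V -> SOmx (U *m V).
Proof.
move=> [Uo Ud] [Vo Vd]; split; last by rewrite det_mulmx Ud Vd mulr1.
by rewrite trmx_mul mulmxA -(mulmxA V^T) Uo mulmx1.
Qed.

Lemma SOmx_tr (U : 'M[R]_N) : SOmx U -> SOmx U^T.
Proof.
by move=> [Uo Ud]; split; rewrite ?det_tr // trmxK; apply: mulmx1C.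
Qed.

Lemma integrable_ntensmx (f : T -> MT) i j : measurable_fun setT f ->
  (forall w, SOmx (f w)) ->
  P.-integrable setT (EFin \o (fun w => ntensmx_rec (f w) k i j)).
Proof.
move=> mf SOf; apply: measurable_bounded_integrable => //.
- by apply: (le_lt_trans (probability_le1 P measurableT)); rewrite ltry.
- by apply: (measurableT_comp (measurable_ntensmx i j)).
- exists 1; split => // M M1 w _; apply: le_trans (ltW M1).
  by apply: ntensmx_entry_le1; case: (SOf w).
Qed.

(** [haarSO] speaks of events; both integrals are rewritten over the laws of [U O] and [O], which
    agree on every measurable set. *)
Lemma Rintegral_haar_shift (U : 'M[R]_N) i j : SOmx U ->
  Rintegral P setT (fun w => ntensmx_rec (U *m O w) k i j) =
  Rintegral P setT (fun w => ntensmx_rec (O w) k i j).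
Proof.
move=> SU; have [mOe SO inv] := hO.
pose UO : T -> MT := fun w => U *m O w.
have mUO : measurable_fun setT UO.
  apply: measurable_matrix => r s; rewrite /UO; under eq_fun do rewrite mxE.
  by apply: measurable_sum => l; apply: measurable_funM.
pose g (M : MT) := ntensmx_rec M k i j.
have push (f : T -> MT) (mf : measurable_fun setT f) : (forall w, SOmx (f w)) ->
    Rintegral P setT (g \o f) = fine (\int[pushforward P f]_y (g y)%:E)%E.
  move=> SOf; rewrite integral_pushforward //.
  - by apply/measurable_EFinP; exact: measurable_ntensmx.
  - exact: integrable_ntensmx.
rewrite -[LHS]/(Rintegral P setT (g \o UO)) -[RHS]/(Rintegral P setT (g \o O)).
rewrite !push //; last by move=> w; apply: SOmxM.
congr fine; apply: eq_measure_integral => A mA _.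
by rewrite /pushforward; apply: inv.
Qed.

Let H := haar_avg P O k.+1.

Lemma haar_avg_mulmxE (x : 'cV[R]_(N ^ k.+1)) i :
  (H *m x) i 0 = Rintegral P setT (fun w => (ntensmx_rec (O w) k *m x) i 0).
Proof.
have [_ SO _] := hO.
rewrite mxE.
under [X in Rintegral _ _ X]eq_fun do rewrite mxE.
under [X in Rintegral _ _ X]eq_fun do under eq_bigr do rewrite mulrC.
rewrite (Rintegral_lincomb _ _ _ _).2 //; last first.
  by move=> j; apply: integrable_ntensmx.
by apply: eq_bigr => j _; rewrite mxE mulrC.
Qed.

Lemma haar_avg_fixed (x : 'cV[R]_(N ^ k.+1)) :
  (forall Q, SOmx Q -> ntensmx_rec Q k *m x = x) -> H *m x = x.
Proof.
move=> Hx; have [_ SO _] := hO.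
apply/matrixP => i j; rewrite ord1 haar_avg_mulmxE.
under [X in Rintegral _ _ X]eq_fun do rewrite Hx //.
by rewrite Rintegral_cst // fine_probT mulr1.
Qed.

(** Left invariance absorbs [U] under the integral, so the range of [H] consists of fixed
    vectors. *)
Lemma haar_avg_invariant (U : 'M[R]_N) : SOmx U -> ntensmx_rec U k *m H = H.
Proof.
move=> SU; have [_ SO _] := hO; apply/matrixP => i j; rewrite mxE [RHS]mxE.
rewrite -[RHS](Rintegral_haar_shift _ _ SU).
under [X in _ = Rintegral _ _ X]eq_fun do rewrite -ntensmx_recM mxE.
rewrite (Rintegral_lincomb _ _ _ _).2 //; last first.
  by move=> l; apply: integrable_ntensmx.
by apply: eq_bigr => l _; rewrite mxE.
Qed.

(** The transpose of [O w] lies in SO(N) and fixes [z] pointwise, so [H^T z = z]. *)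
Lemma dot_haar_avg (x z : 'cV[R]_(N ^ k.+1)) :
  (forall Q, SOmx Q -> ntensmx_rec Q k *m z = z) -> dot (H *m x) z = dot x z.
Proof.
move=> Hz; have [_ SO _] := hO.
have HTz : H^T *m z = z.
  apply/matrixP => i j; rewrite ord1 mxE.
  transitivity (Rintegral P setT (fun w => \sum_l z l 0 * ntensmx_rec (O w) k l i)).
    rewrite (Rintegral_lincomb _ _ _ _).2 //; last first.
      by move=> l; apply: integrable_ntensmx.
    by apply: eq_bigr => l _; rewrite !mxE mulrC.
  rewrite (_ : (fun w => _) = cst (z i 0)).
    by rewrite Rintegral_cst // fine_probT mulr1.
  apply/funext => w /=; rewrite -[in RHS](Hz _ (SOmx_tr (SO w))) ntensmx_rec_tr mxE.
  by apply: eq_bigr => l _; rewrite mxE mulrC.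
by rewrite dot_mulmxl HTz.
Qed.

End Haar.

(** * The spectral gap *)

Lemma vnormE (R : realType) (n : nat) (x : 'cV[R]_n) : vnorm x = Num.sqrt (dot x x).
Proof. by rewrite /vnorm dotE; under [in RHS]eq_bigr do rewrite -expr2. Qed.

Lemma opnorm_le (R : realType) (n : nat) (A : 'M[R]_n) (c : R) : 0 <= c ->
  (forall x, dot (A *m x) (A *m x) <= c ^+ 2 * dot x x) -> opnorm A <= c.
Proof.
move=> c0 Ac; apply: ge_sup.
  exists (vnorm (A *m 0)), 0 => //=.
  by rewrite vnormE dot0l sqrtr0 ler01.
move=> _ [x /= x1 <-]; rewrite -[X in _ <= X]mulr1; apply: le_trans (ler_wpM2l c0 x1).
rewrite !vnormE -[c in X in _ <= X]ger0_norm // -sqrtr_sqr -sqrtrM ?sqr_ge0 //.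
exact: ler_wsqrtr.
Qed.

Lemma natr_card_pairs (R : realType) (N : nat) :
  #|pairs N|%:R = N%:R * (N%:R - 1) / 2 :> R.
Proof.
have := @sum_ltn_pairs R^o N (fun a b => (a != b)%:R).
rewrite /= => /(_ (fun a b => congr1 (fun c : bool => (~~ c)%:R) (eq_sym a b))).
move=> /(_ (fun a => congr1 (fun c : bool => (~~ c)%:R) (eqxx a))).
rewrite (eq_bigr (fun=> N%:R - 1)) => [|a _]; last first.
  under eq_bigr do rewrite -[_%:R](subKr 1).
  rewrite sumrB sumr_const card_ord; congr (_ - _).
  rewrite (bigD1 a) //= eqxx subr0 big1 ?addr0 // => b ba.
  by rewrite eq_sym ba subrr.
rewrite sumr_const card_ord (eq_bigr (fun=> 1)) => [|p pp]; last first.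
  by rewrite -val_eqE neq_ltn pp.
have -> : #|pairs N|%:R = \sum_(p : 'I_N * 'I_N | (p.1 < p.2)%N) 1 :> R.
  by rewrite -sum1_card natr_sum; apply: eq_bigl => p; rewrite inE.
set S := \sum_(_ | _) _ => h.
have {}h : (N%:R - 1) * N%:R = S * 2%:R by rewrite !mulr_natr.
by rewrite mulrC in h; rewrite h mulfK ?pnatr_eq0.
Qed.

Section Main.
Variables (R : realType) (N k : nat).
Let D (a b : 'I_N) : 'M[R]_(N ^ k.+1) := tensder (Emx R a b) k.

Lemma tensder_skew a b : (D a b)^T = - D a b.
Proof. by rewrite /D -tensder_tr Emx_tr tensderN. Qed.

Lemma tensder_anti a b : D b a = - D a b.
Proof. by rewrite /D Emx_anti tensderN. Qed.

Lemma tensder_bracket a b c d : D a b *m D c d - D c d *m D a b =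
  (b == c)%:R *: D a d - (a == c)%:R *: D b d
  - (b == d)%:R *: D a c + (a == d)%:R *: D b c.
Proof.
by rewrite /D tensder_comm Emx_comm !(tensderD, tensderN, tensderZ).
Qed.

(** From the Lie algebra to the group: each plane rotation fixes the kernel of its own generator,
    and plane rotations generate SO(N). *)
Lemma SOmx_fixes_invariant (x : 'cV[R]_(N ^ k.+1)) Q :
  invariant D x -> SOmx Q -> ntensmx_rec Q k *m x = x.
Proof.
move=> Dx; apply: (SOmx_generated (F := fun Q => ntensmx_rec Q k *m x = x)).
- by rewrite ntensmx_rec1 mul1mx.
- by move=> A B Ax Bx; rewrite -ntensmx_recM -mulmxA Bx Ax.
- move=> a b co si ab /circle_angle[th [-> ->]].
  have [I [w [A [B fX]]]] := tensrot_trig_expansion R k ab.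
  exact: (trig_invariant fX (ntensmx_planerot0 _ _ _ _) th (Dx a b)).
Qed.

Lemma fixed_invariant (x : 'cV[R]_(N ^ k.+1)) :
  (forall Q, SOmx Q -> ntensmx_rec Q k *m x = x) -> invariant D x.
Proof.
move=> Qx a b; have [->|ab] := eqVneq a b.
  by rewrite (Ddiag tensder_anti) mul0mx.
have [I [w [A [B fX]]]] := tensrot_trig_expansion R k ab.
apply: (fixed_tensder0 fX) => th; apply: Qx.
by split; [apply: planerot_orth|apply: det_planerot]; rewrite ?cos2Dsin2.
Qed.

End Main.

Theorem theorem6p2 (R : realType) (N t : nat) (hN : (3 <= N)%N) (ht : (1 <= t)%N)
  (d : measure_display) (T : measurableType d) (P : probability T R)
  (O : T -> 'M[R]_N) (hO : haarSO P O) :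
  opnorm (rot_avg R N t - haar_avg P O t)
    <= 1 - t%:R^-1 * ((2 * (N - 2)%:R) / (N%:R * (N - 1)%:R))
         - 2 / (N%:R * (N - 1)%:R).
Proof.
case: t ht => // k _.
have N3 : 3 <= N%:R :> R by rewrite ler_nat.
have N1E : (N - 1)%:R = N%:R - 1 :> R by rewrite natrB // (leq_trans _ hN).
have N2E : (N - 2)%:R = N%:R - 2 :> R by rewrite natrB // (leq_trans _ hN).
have cardE := natr_card_pairs R N.
have card0 : 0 < #|pairs N|%:R :> R by rewrite cardE; nra.
have k1 : 1 <= k.+1%:R :> R by rewrite ler1n.
(* Since [2 / (N (N - 1))] is the inverse of the number of pairs, the two subtracted fractions merge
   into one quotient. *)
pose beta : R := 1 - (1 + (N - 2)%:R / k.+1%:R) / #|pairs N|%:R.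
have -> : 1 - k.+1%:R^-1 * ((2 * (N - 2)%:R) / (N%:R * (N - 1)%:R))
         - 2 / (N%:R * (N - 1)%:R) = beta.
  rewrite /beta cardE N1E; field; rewrite !gt_eqF //; lra.
(* [1 + (N - 2) / t <= N - 1 <= N (N - 1) / 2]; the sign matters because the norm bound is proved
   through squares. *)
have beta0 : 0 <= beta.
  rewrite subr_ge0 ler_pdivrMr // mul1r.
  apply: (@le_trans _ _ (1 + (N%:R - 2))); last by rewrite cardE; nra.
  rewrite lerD2l N2E ler_pdivrMr ?(lt_le_trans ltr01) //.
  by rewrite ler_peMr // subr_ge0; lra.
have npE : #|pairs N| = (\sum_(p : 'I_N * 'I_N | (p.1 < p.2)%N) 1)%N.
  by rewrite -sum1_card; apply: eq_bigl => p; rewrite inE.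
apply: opnorm_le => // x; rewrite rot_avgE.
have := @average_gap R _ N _ (@tensder_skew R N k) (@tensder_anti R N k)
  (@tensder_bracket R N k) k.+1 (rot_proj R k) isT _ _ (haar_avg P O k.+1) x.
rewrite -npE; apply.
- move=> a b ab y; have [I [w [A [B fX]]]] := tensrot_trig_expansion R k ab.
  exact: (trig_roots fX (ntensmx_planerot0 _ _ _ _)).
- move=> a b ab m y mk Sy; have [I [w [A [B fX]]]] := tensrot_trig_expansion R k ab.
  by rewrite (rot_projE ab fX); apply: (zero_partE fX (ntensmx_planerot0 _ _ _ _)).
- by rewrite -(ltr0n R).
- exact: beta0.
- move=> y Iy; apply: haar_avg_fixed => // Q SQ; exact: SOmx_fixes_invariant.
(* [H y] is fixed by SO(N), hence invariant, so [dot (H y) (H y) = dot y (H y)], which vanishes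
   because [y] is orthogonal to the invariants. *)
- move=> y Hy; apply/eqP; rewrite -dot_eq0; apply/eqP.
  have Hinv : forall Q, SOmx Q ->
      ntensmx_rec Q k *m (haar_avg P O k.+1 *m y) = haar_avg P O k.+1 *m y.
    by move=> Q SQ; rewrite mulmxA haar_avg_invariant.
  by rewrite dot_haar_avg // Hy //; apply: fixed_invariant.
Qed.
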